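(* Let $\mathcal P_t=e^{t\mathcal L}$ be a primitive quantum Markov semigroup satisfying the $\sigma$-GNS detailed balance condition for its full-rank invariant state $\sigma$. Then for every $p\in\mathbb R\setminus\{0,1\}$, $$2\,\alpha_p(\mathcal L)\le\lambda(\mathcal L),$$ where $\alpha_p(\mathcal L)$ is the optimal constant in the $p$-Beckner inequality and $\lambda(\mathcal L)$ is the Poincaré constant (spectral gap).
   Context: $\mathcal H$ is a finite-dimensional Hilbert space, $\mathcal B(\mathcal H)$ the operators on it, $\mathbf 1$ the identity. A quantum Markov semigroup (QMS) is a $C_0$-semigroup $(\mathcal P_t)_{t\ge0}$ of completely positive unital maps on $\mathcal B(\mathcal H)$, with generator $\mathcal L$; $\dagger$ is the adjoint for the Hilbert–Schmidt inner product. It is primitive if it has a unique invariant state $\sigma$ ($\mathcal P_t^\dagger(\sigma)=\sigma$ for all $t$) and $\sigma$ has full rank. The $\sigma$-GNS detailed balance condition means that $\mathcal L$ is self-adjoint for $\langle X,Y\rangle_{\sigma,1}=\mathrm{Tr}(\sigma X^*Y)$. Put $\langle X,Y\rangle_{\sigma,1/2}=\mathrm{Tr}(\sigma^{1/2}X^*\sigma^{1/2}Y)$. Let $\Gamma_\sigma^{s}(X)=\sigma^{s/2}X\sigma^{s/2}$ for $s\in\mathbb R$, $\hat p=p/(p-1)$, and for $X>0$, $\|X\|_{p,\sigma}=\mathrm{Tr}\big((\Gamma_\sigma^{1/p}(X))^p\big)^{1/p}$, $$\mathcal E_{p,\mathcal L}(X)=-\frac{\hat p\,p}{4}\Big\langle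 \Gamma_\sigma^{-1/\hat p}\big((\Gamma_\sigma^{1/p}(X))^{p-1}\big),\mathcal L(X)\Big\rangle_{\sigma,1/2}.$$ The $p$-Beckner inequality with constant $\alpha_p$ is $\alpha_p\,\hat p\,(\|X\|_{p,\sigma}^p-\|X\|_{1,\sigma}^p)\le\mathcal E_{p,\mathcal L}(X)$ for all $X>0$, and $\alpha_p(\mathcal L)$ is the largest such constant. The Poincaré constant is $$\lambda(\mathcal L)=\inf_{X\in\mathcal B(\mathcal H),\,X\notin\mathbb C\mathbf 1}\frac{-\langle X,\mathcal L X\rangle_{\sigma,1/2}}{\|X-\mathrm{Tr}(\sigma X)\mathbf 1\|_{2,\sigma}^2},\qquad \|Z\|_{2,\sigma}^2=\langle Z,Z\rangle_{\sigma,1/2}.$$ *)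

(* Defs.v *)
From HB Require Import structures.
From mathcomp Require Import all_boot all_order all_algebra.
From mathcomp Require Import sesquilinear spectral.
From mathcomp Require Import complex.
From mathcomp Require Import all_classical all_reals all_analysis.

Set Implicit Arguments.
Unset Strict Implicit.
Unset Printing Implicit Defensive.

Import Order.TTheory GRing.Theory Num.Theory.
Import numFieldNormedType.Exports.

Local Open Scope ring_scope.
Local Open Scope complex_scope.
Local Open Scope sesquilinear_scope.
Local Open Scope classical_set_scope.

(* The Hilbert space is C^n with C = R[i], and B(C^n) is 'M[R[i]]_n. In the
   order of R[i], 0 <= z and 0 < z entail that z is real. *)

Definition psdmx (R : realType) (n : nat) (A : 'M[R[i]]_n) : Prop :=
  forall v : 'cV[R[i]]_n, 0 <= (v ^t* *m A *m v) 0 0.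

Definition posdefmx (R : realType) (n : nat) (A : 'M[R[i]]_n) : Prop :=
  forall v : 'cV[R[i]]_n, v != 0 -> 0 < (v ^t* *m A *m v) 0 0.

Definition is_state (R : realType) (n : nat) (rho : 'M[R[i]]_n) : Prop :=
  psdmx rho /\ \tr rho = 1.

(* Functional calculus: spectralmx A is unitary and, for normal A,
   A = invmx (spectralmx A) *m diag_mx (spectral_diag A) *m spectralmx A.
   Only used for positive definite A, whose eigenvalues are positive reals. *)
Definition mxpow (R : realType) (n : nat) (A : 'M[R[i]]_n) (s : R) :
    'M[R[i]]_n :=
  invmx (spectralmx A)
  *m diag_mx (map_mx (fun z : R[i] => (complex.Re z `^ s)%:C) (spectral_diag A))
  *m spectralmx A.

Definition completely_positive (R : realType) (n : nat)
    (Phi : 'M[R[i]]_n -> 'M[R[i]]_n) : Prop :=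
  forall (k : nat) (A : 'M[R[i]]_(\sum_(i < k) n)), psdmx A ->
    psdmx (\mxblock_(i < k, j < k) Phi (submxblock A i j)).

Definition hs_inner (R : realType) (n : nat) (X Y : 'M[R[i]]_n) : R[i] :=
  \tr (X ^t* *m Y).

(* Explicit Hilbert-Schmidt adjoint, see hs_adjointP below. *)
Definition hs_adjoint (R : realType) (n : nat)
    (Phi : 'M[R[i]]_n -> 'M[R[i]]_n) (Y : 'M[R[i]]_n) : 'M[R[i]]_n :=
  \matrix_(i, j) hs_inner (Phi (delta_mx i j)) Y.

Lemma hs_adjointP (R : realType) (n : nat)
    (Phi : {linear 'M[R[i]]_n -> 'M[R[i]]_n}) (X Y : 'M[R[i]]_n) :
  hs_inner (Phi X) Y = hs_inner X (hs_adjoint Phi Y).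
Proof.
have hsE Z W : hs_inner Z W = \sum_j \sum_i (Z i j)^* * W i j :> R[i].
  by apply: eq_bigr => j _; rewrite !mxE; apply: eq_bigr => i _; rewrite !mxE.
have hsDl Z1 Z2 : hs_inner (Z1 + Z2) Y = hs_inner Z1 Y + hs_inner Z2 Y.
  rewrite !hsE -big_split; apply: eq_bigr => j _ /=.
  by rewrite -big_split; apply: eq_bigr => i _ /=; rewrite mxE rmorphD mulrDl.
have hsZl a Z : hs_inner (a *: Z) Y = a^* * hs_inner Z Y.
  rewrite !hsE mulr_sumr; apply: eq_bigr => j _ /=.
  by rewrite mulr_sumr; apply: eq_bigr => i _; rewrite mxE rmorphM mulrA.
have hs0l : hs_inner 0 Y = 0.
  by rewrite -(scale0r (0 : 'M[R[i]]_n)) hsZl rmorph0 mul0r.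
rewrite [in LHS](matrix_sum_delta X) [RHS]hsE exchange_big /= linear_sum /=.
rewrite (big_morph (fun Z => hs_inner Z Y) hsDl hs0l).
apply: eq_bigr => i _; rewrite linear_sum /=.
rewrite (big_morph (fun Z => hs_inner Z Y) hsDl hs0l).
by apply: eq_bigr => j _; rewrite linearZ /= hsZl mxE.
Qed.

(* The type (R[i])^o carries the topology of the modulus on R[i]; matrices over
   it have the entrywise topology, the usual one in finite dimension. *)
Record is_QMS (R : realType) (n : nat)
    (P : R -> {linear 'M[R[i]]_n -> 'M[R[i]]_n}) : Prop := {
  qms0 : forall X, P 0 X = X;
  qmsD : forall s t X, 0 <= s -> 0 <= t -> P (s + t) X = P s (P t X);
  qms_continuous : forall X,
    (P t X : 'M[(R[i])^o]_n) @[t --> 0^'+] --> (X : 'M[(R[i])^o]_n);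
  qms_cp : forall t, 0 <= t -> completely_positive (P t);
  qms_unital : forall t, 0 <= t -> P t 1%:M = 1%:M
}.

Definition is_generator (R : realType) (n : nat)
    (P : R -> {linear 'M[R[i]]_n -> 'M[R[i]]_n})
    (L : {linear 'M[R[i]]_n -> 'M[R[i]]_n}) : Prop :=
  forall X, (((t^-1)%:C *: (P t X - X)) : 'M[(R[i])^o]_n) @[t --> 0^'+]
    --> (L X : 'M[(R[i])^o]_n).

Definition invariant_state (R : realType) (n : nat)
    (P : R -> {linear 'M[R[i]]_n -> 'M[R[i]]_n}) (rho : 'M[R[i]]_n) : Prop :=
  is_state rho /\ forall t, 0 <= t -> hs_adjoint (P t) rho = rho.

Definition primitive (R : realType) (n : nat)
    (P : R -> {linear 'M[R[i]]_n -> 'M[R[i]]_n}) : Prop :=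
  exists sigma : 'M[R[i]]_n,
    [/\ invariant_state P sigma,
        forall rho, invariant_state P rho -> rho = sigma
      & \rank sigma = n].

Definition gns_inner (R : realType) (n : nat) (sigma X Y : 'M[R[i]]_n) : R[i] :=
  \tr (sigma *m X ^t* *m Y).

Definition kms_inner (R : realType) (n : nat) (sigma X Y : 'M[R[i]]_n) : R[i] :=
  \tr (mxpow sigma 2^-1 *m X ^t* *m mxpow sigma 2^-1 *m Y).

Definition gns_detailed_balance (R : realType) (n : nat)
    (sigma : 'M[R[i]]_n) (L : {linear 'M[R[i]]_n -> 'M[R[i]]_n}) : Prop :=
  forall X Y, gns_inner sigma (L X) Y = gns_inner sigma X (L Y).

Definition Gamma (R : realType) (n : nat) (sigma : 'M[R[i]]_n) (s : R)
    (X : 'M[R[i]]_n) : 'M[R[i]]_n :=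
  mxpow sigma (s / 2) *m X *m mxpow sigma (s / 2).

Definition hat (R : realType) (p : R) : R := p / (p - 1).

(* The trace is a positive real when X and sigma are positive definite. *)
Definition Lpnorm (R : realType) (n : nat) (sigma : 'M[R[i]]_n) (p : R)
    (X : 'M[R[i]]_n) : R :=
  complex.Re (\tr (mxpow (Gamma sigma p^-1 X) p)) `^ p^-1.

(* The inner product is real, both of its arguments being Hermitian when X is
   positive definite. *)
Definition beckner_energy (R : realType) (n : nat) (sigma : 'M[R[i]]_n) (p : R)
    (L : {linear 'M[R[i]]_n -> 'M[R[i]]_n}) (X : 'M[R[i]]_n) : R :=
  - (hat p * p / 4) *
    complex.Re (kms_inner sigma
      (Gamma sigma (- (hat p)^-1) (mxpow (Gamma sigma p^-1 X) (p - 1))) (L X)).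

Definition beckner_inequality (R : realType) (n : nat) (sigma : 'M[R[i]]_n)
    (p : R) (L : {linear 'M[R[i]]_n -> 'M[R[i]]_n}) (a : R) : Prop :=
  forall X : 'M[R[i]]_n, posdefmx X ->
    a * hat p * (Lpnorm sigma p X `^ p - Lpnorm sigma 1 X `^ p)
      <= beckner_energy sigma p L X.

(* Extended real values: for n = 1 every constant is admissible and the infimum
   defining the Poincare constant is over the empty set, so both are +oo. *)
Definition beckner_constant (R : realType) (n : nat) (sigma : 'M[R[i]]_n)
    (p : R) (L : {linear 'M[R[i]]_n -> 'M[R[i]]_n}) : \bar R :=
  ereal_sup [set a%:E | a in [set a : R | beckner_inequality sigma p L a]].

(* Numerator and denominator are real, since detailed balance makes L
   self-adjoint for kms_inner as well. *)
Definition poincare_quotient (R : realType) (n : nat) (sigma : 'M[R[i]]_n)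
    (L : {linear 'M[R[i]]_n -> 'M[R[i]]_n}) (X : 'M[R[i]]_n) : R :=
  let Z := X - (\tr (sigma *m X))%:M in
  - complex.Re (kms_inner sigma X (L X)) / complex.Re (kms_inner sigma Z Z).

Definition poincare_constant (R : realType) (n : nat) (sigma : 'M[R[i]]_n)
    (L : {linear 'M[R[i]]_n -> 'M[R[i]]_n}) : \bar R :=
  ereal_inf [set (poincare_quotient sigma L X)%:E
            | X in [set X : 'M[R[i]]_n | ~~ is_scalar_mx X]].

(* Main.v *)
Require Import Defs.
From mathcomp Require Import all_boot all_order all_algebra.
From mathcomp Require Import sesquilinear spectral complex.
From mathcomp Require Import all_classical all_reals all_analysis.
From mathcomp Require Import ring lra.

(** A Beckner inequality with constant a, tested on X = 1 + t Y with Y Hermitian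
    and tr (sigma Y) = 0, has both sides of order t^2.  In an eigenbasis of
    sigma (eigenvalues s_i) the t^2 coefficients give
      2 a sum_ij k(s_i, s_j) |Y_ij|^2
        <= - Re sum_ij k(s_i, s_j) conj(Y_ij) (L Y)_ij        (1)
    where k is the kernel beckner_kernel, built from the divided difference of
    x^(p-1) at the points s_i^(1/p), s_j^(1/p)  (beckner_linearized).  The
    Poincare inequality 2 a <= lambda is (1) with k(x, y) replaced by
    x^(1/2) y^(1/2), the kernel of the KMS inner product.

    The passage from one kernel to the other uses GNS symmetry: it forces L to
    commute with the modular map X |-> sigma X sigma^-1, so the matrix
    coefficient of L from position (k, l) to position (i, j) vanishes unless
    s_i / s_j = s_k / s_l  (eigcoord_modular).  Hence L commutes with every
    entrywise multiplication by a function of s_i / s_j  (schur_mul_commutes).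
    Since k is positive and homogeneous of degree one, the multiplier
    sqrt (s_i^(1/2) s_j^(1/2) / k(s_i, s_j)) is such a function; applying (1)
    to X multiplied entrywise by it yields the KMS inequality for Hermitian X
    (hermitian_gap).  A general X is reduced to the Hermitian matrices X + X^dag
    and i (X - X^dag), because L, as the derivative of completely positive maps,
    preserves Hermitian matrices.

    The expansion of tr (A + t B)^p is obtained without perturbation theory of
    eigenvectors.  If W is the overlap matrix of eigenbases of M = A + t B and
    A, then W_ik (m_k - a_i) is t times a bounded quantity (overlap_le).  The
    matrix M^s minus its linear interpolation at the nodes a_i, a_j carries the
    factor (m_k - a_i) (m_k - a_j) by Newton interpolation
    (powR_newton_bound), so the (i, j) entry of M^s is known up to O(t^2)
    (mxpow_first_order).  Used with M itself as base point this differentiates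
    t |-> tr M^p, and the mean value theorem then provides the second order
    (trace_mxpow_second_order). *)

Set Implicit Arguments.
Unset Strict Implicit.
Unset Printing Implicit Defensive.
Import Order.TTheory GRing.Theory Num.Theory.
Import numFieldNormedType.Exports.
Local Open Scope ring_scope.
Local Open Scope complex_scope.
Local Open Scope sesquilinear_scope.
Local Open Scope classical_set_scope.

(** * Divided differences of real powers *)

Lemma powR_mvt (R : realType) (q x y : R) : 0 < x -> x < y ->
  exists2 u, x < u < y & y `^ q - x `^ q = q * u `^ (q - 1) * (y - x).
Proof.
move=> x0 xy.
have der u : u \in `]x, y[%R -> is_derive u 1 (@powR R ^~ q) (q * u `^ (q - 1)).
  by rewrite in_itv/= => /andP[xu _]; apply: is_derive1_powR; lra.
have cont : {within `[x, y], continuous (@powR R ^~ q)}.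
  apply: continuous_in_subspaceT => u; rewrite inE/= in_itv/= => /andP[xu _].
  apply: differentiable_continuous; apply/derivable1_diffP.
  by apply: derivable_powR; rewrite in_itv/= andbT; lra.
by have [u uI ->] := MVT xy der cont; exists u => //; move: uI; rewrite in_itv.
Qed.

Lemma powR_lipschitz (R : realType) (q c d : R) : 0 < c ->
  exists2 K, 0 <= K & forall x y, c <= x <= d -> c <= y <= d ->
    `|x `^ q - y `^ q| <= K * `|x - y|.
Proof.
move=> c0; pose K := `|q| * (c `^ (q - 1) + d `^ (q - 1)).
have K0 : 0 <= K by rewrite mulr_ge0// addr_ge0// powR_ge0.
have bound u : c <= u <= d -> `|q * u `^ (q - 1)| <= K.
  move=> /andP[cu ud]; have u0 := lt_le_trans c0 cu.
  rewrite normrM ler_wpM2l// ger0_norm ?powR_ge0//.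
  have [q1|q1] := leP 0 (q - 1).
    apply: (@le_trans _ _ (d `^ (q - 1))); last by rewrite lerDr powR_ge0.
    by apply: ge0_ler_powR => //; rewrite nnegrE; lra.
  apply: (@le_trans _ _ (c `^ (q - 1))); last by rewrite lerDl powR_ge0.
  have -> : q - 1 = - (1 - q) by ring.
  rewrite !powRN lef_pV2 ?posrE ?powR_gt0//.
  by apply: ge0_ler_powR => //; rewrite ?nnegrE; lra.
exists K => //.
suff main x y : c <= x -> x < y -> y <= d -> `|y `^ q - x `^ q| <= K * `|y - x|.
  move=> x y /andP[cx xd] /andP[cy yd]; have [xy|yx|->] := ltgtP x y.
  - by rewrite distrC (distrC x) main.
  - by rewrite main.
  - by rewrite !subrr normr0 mulr0.
move=> cx xy yd.
have [|u /andP[xu uy] ->] := powR_mvt q _ xy; first by lra.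
by rewrite normrM ler_wpM2r// bound//; lra.
Qed.

Definition powR_divdiff (R : realType) (q x y : R) : R :=
  if x == y then q * x `^ (q - 1) else (x `^ q - y `^ q) / (x - y).

Lemma powR_divdiffC (R : realType) (q x y : R) :
  powR_divdiff q x y = powR_divdiff q y x.
Proof.
rewrite /powR_divdiff eq_sym; case: (eqVneq x y) => [->//|_].
by rewrite -[RHS]mulrNN -invrN !opprB.
Qed.

Lemma powR_divdiff_gt0 (R : realType) (q x y : R) : q != 0 -> 0 < x -> 0 < y ->
  0 < powR_divdiff q x y / q.
Proof.
move=> q0 x0 y0; rewrite /powR_divdiff.
have [_|xy] := eqVneq x y; first by rewrite mulrAC mulfV// mul1r powR_gt0.
suff main u v : 0 < u -> u < v -> 0 < (v `^ q - u `^ q) / (v - u) / q.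
  move: xy; rewrite neq_lt => /orP[] xy; last exact: main.
  by rewrite -[X in X / q]mulrNN -invrN !opprB; apply: main.
move=> u0 uv; rewrite mulrAC divr_gt0 ?subr_gt0//.
have [qlt|qgt|/eqP] := ltgtP q 0; last by rewrite (negPf q0).
  rewrite nmulr_lgt0 ?invr_lt0// subr_lt0 -(opprK q) !(powRN _ (- q)).
  rewrite ltf_pV2 ?posrE ?powR_gt0//; last by lra.
  by apply: gt0_ltr_powR => //; rewrite ?nnegrE; lra.
rewrite divr_gt0// subr_gt0.
by apply: gt0_ltr_powR => //; rewrite ?nnegrE; lra.
Qed.

Lemma powR_divdiff_homo (R : realType) (q l x y : R) : 0 < l -> 0 < x -> 0 < y ->
  powR_divdiff q (l * x) (l * y) = l `^ (q - 1) * powR_divdiff q x y.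
Proof.
move=> l0 x0 y0; rewrite /powR_divdiff (inj_eq (mulfI (lt0r_neq0 l0))).
case: (eqVneq x y) => [_|xy]; first by rewrite (powRM _ (ltW l0) (ltW x0)) mulrCA.
rewrite !(powRM _ (ltW l0)) ?(ltW x0) ?(ltW y0)// -!mulrBr powRB; last first.
  by apply/implyP => _; exact: lt0r_neq0.
rewrite (powRr1 (ltW l0)); field.
by rewrite subr_eq0 xy (lt0r_neq0 l0).
Qed.

(** The second divided difference of x^q with nodes x, y, z is bounded on a
    compact interval of positive reals.  For y <> z it is a difference quotient,
    between y and z, of first divided differences, so K may depend on |z - y|
    and only the Lipschitz bound for x^q is needed; for y = z the mean value
    theorem reduces it to the Lipschitz bound for x^(q-1). *)
Lemma powR_newton_bound (R : realType) (q c d y z : R) : 0 < c ->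
  c <= y <= d -> c <= z <= d ->
  exists2 K, 0 <= K & forall x, c <= x <= d ->
    `|x `^ q - y `^ q - powR_divdiff q z y * (x - y)|
      <= K * (`|x - z| * `|x - y|).
Proof.
move=> c0 yI zI; rewrite /powR_divdiff; case: (eqVneq z y) => [->|zy].
  have [K K0 lipK] := @powR_lipschitz R (q - 1) c d c0.
  exists (`|q| * K); first by rewrite mulr_ge0.
  suff main x x' w : c <= x -> x < x' -> x' <= d -> x <= w <= x' ->
      `|x' `^ q - x `^ q - q * w `^ (q - 1) * (x' - x)|
      <= `|q| * K * (`|x' - x| * `|x' - x|).
    move: yI => /andP[cy yd] x /andP[cx xd]; have [xy|yx|->] := ltgtP x y; last first.
    - by rewrite !(subrr, mulr0, normr0).
    - by apply: main => //; rewrite (ltW yx) lexx.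
    - rewrite -normrN (distrC x); set e := (X in `|X|).
      have -> : e = y `^ q - x `^ q - q * y `^ (q - 1) * (y - x) by rewrite /e; ring.
      by apply: main => //; rewrite (ltW xy) lexx.
  move=> cx xx' x'd wI.
  have [|u /andP[xu ux'] ->] := powR_mvt q _ xx'; first by lra.
  rewrite -mulrBl -mulrBr !normrM -!mulrA ler_wpM2l// mulrA ler_wpM2r//.
  apply: (le_trans (lipK _ _ _ _)); [lra|lra|].
  rewrite ler_wpM2l// (gtr0_norm (_ : 0 < x' - x)); last by lra.
  by rewrite ler_norml; lra.
have [K K0 lipK] := @powR_lipschitz R q c d c0.
exists (2 * K / `|z - y|); first by rewrite divr_ge0// mulr_ge0.
move=> x xI; have zy0 : z - y != 0 by rewrite subr_eq0.
have -> : x `^ q - y `^ q - (z `^ q - y `^ q) / (z - y) * (x - y) =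
  ((x `^ q - y `^ q) * (z - x) - (z `^ q - x `^ q) * (x - y)) / (z - y) by field.
rewrite normrM normfV mulrAC ler_pM2r ?invr_gt0 ?normr_gt0//.
apply: (le_trans (ler_normB _ _)); rewrite !normrM.
have := lipK _ _ xI yI; have := lipK _ _ zI xI; rewrite (distrC z x).
move: (`|x - z|) (`|x - y|) (normr_ge0 (x - z)) (normr_ge0 (x - y)).
move=> a b a0 b0 h1 h2.
have := ler_wpM2r a0 h2; have := ler_wpM2r b0 h1; lra.
Qed.

(** * Spectral decomposition of Hermitian matrices *)

Lemma normc_real (R : realType) (t : R) : `|t%:C : R[i]| = `|t|%:C.
Proof. by rewrite normc_def /= expr0n addr0 sqrtr_sqr. Qed.

Lemma Re_sum (R : realType) (I : finType) (F : I -> R[i]) :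
  complex.Re (\sum_i F i) = \sum_i complex.Re (F i).
Proof. by apply: (big_morph (@complex.Re R)) => // -[a b] [c d]. Qed.

Lemma realc_sum (R : realType) (I : finType) (F : I -> R) :
  (\sum_i F i)%:C = \sum_i (F i)%:C :> R[i].
Proof. exact: (big_morph (real_complex R) (rmorphD _) (rmorph0 _)). Qed.

Lemma Re_realM (R : realType) (t : R) (z : R[i]) :
  complex.Re (t%:C * z) = t * complex.Re z.
Proof. by case: z => a b /=; rewrite mul0r subr0. Qed.

Lemma conj_realc (R : realType) (t : R) : Num.conj (t%:C : R[i]) = t%:C.
Proof. exact: conjc_real. Qed.

Lemma Re_real_mulACA (R : realType) (a b : R) (u v : R[i]) :
  complex.Re (a%:C * u * (b%:C * v)) = a * b * complex.Re (u * v).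
Proof. by rewrite mulrACA -rmorphM/= Re_realM. Qed.

Lemma adjM (C : numClosedFieldType) m n p (A : 'M[C]_(m, n)) (B : 'M[C]_(n, p)) :
  (A *m B)^t* = B^t* *m A^t*.
Proof. by rewrite trmx_mul map_mxM. Qed.

Lemma adjD (C : numClosedFieldType) m n (A B : 'M[C]_(m, n)) :
  (A + B)^t* = A^t* + B^t*.
Proof. by rewrite linearD map_mxD. Qed.

Lemma adjZ (C : numClosedFieldType) m n a (A : 'M[C]_(m, n)) :
  (a *: A)^t* = Num.conj a *: A^t*.
Proof. by rewrite linearZ map_mxZ. Qed.

Lemma unitarymx_adjl (C : numClosedFieldType) n (U : 'M[C]_n) :
  U \is unitarymx -> U^t* *m U = 1%:M.
Proof.
by move=> Uu; rewrite -invmx_unitary// mulVmx// unitarymx_unit.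
Qed.

Lemma unitarymx_adj (C : numClosedFieldType) n (U : 'M[C]_n) :
  U \is unitarymx -> U^t* \is unitarymx.
Proof. by rewrite trmxC_unitary. Qed.

Lemma invmx_spectralmx (C : numClosedFieldType) n (A : 'M[C]_n) :
  invmx (spectralmx A) = (spectralmx A)^t*.
Proof. exact: invmx_unitary (spectral_unitarymx A). Qed.

Definition realdiag (R : realType) (n : nat) (m : 'I_n -> R) : 'M[R[i]]_n :=
  diag_mx (\row_k (m k)%:C).

(** Meaningful for Hermitian M, for which the complex spectral diagonal is
    real. *)
Definition eigval (R : realType) (n : nat) (M : 'M[R[i]]_n) (k : 'I_n) : R :=
  complex.Re (spectral_diag M 0 k).

Lemma realdiag_mull (R : realType) (n p : nat) (m : 'I_n -> R) (A : 'M[R[i]]_(n, p)) i j :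
  (realdiag m *m A) i j = (m i)%:C * A i j.
Proof. by rewrite mul_diag_mx !mxE. Qed.

Lemma realdiag_mulr (R : realType) (n p : nat) (m : 'I_n -> R) (A : 'M[R[i]]_(p, n)) i j :
  (A *m realdiag m) i j = A i j * (m j)%:C.
Proof. by rewrite mul_mx_diag !mxE. Qed.

Lemma realdiag_adj (R : realType) (n : nat) (m : 'I_n -> R) :
  (realdiag m)^t* = realdiag m.
Proof.
apply/matrixP => i j; rewrite !mxE; case: (eqVneq i j) => [->|_].
  exact: conj_realc.
by rewrite rmorph0.
Qed.

Lemma mxpowE (R : realType) (n : nat) (M : 'M[R[i]]_n) s :
  mxpow M s =
  (spectralmx M)^t* *m realdiag (fun k => eigval M k `^ s) *m spectralmx M.
Proof.
rewrite /mxpow invmx_spectralmx; have -> // :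
  map_mx (fun z : R[i] => (complex.Re z `^ s)%:C) (spectral_diag M) =
  \row_k (eigval M k `^ s)%:C.
by apply/rowP => k; rewrite !mxE.
Qed.

Lemma hermitian_spectral (R : realType) (n : nat) (M : 'M[R[i]]_n) :
  M^t* = M ->
  M = (spectralmx M)^t* *m realdiag (eigval M) *m spectralmx M.
Proof.
move=> Mh; have herm : M \is hermsymmx.
  by rewrite is_hermitianmxE expr0 scale1r Mh.
have /orthomx_spectralP ME := hermitian_normalmx herm.
have diagE : spectral_diag M = \row_k (eigval M k)%:C.
  apply/rowP => k; rewrite mxE /eigval RRe_real//.
  by have /mxOverP := hermitian_spectral_diag_real herm; apply.
by apply: etrans ME _; rewrite invmx_spectralmx {1}diagE.
Qed.

Lemma mxpow_adj (R : realType) (n : nat) (M : 'M[R[i]]_n) s :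
  (mxpow M s)^t* = mxpow M s.
Proof. by rewrite mxpowE !adjM trmxCK realdiag_adj mulmxA. Qed.

Lemma unitarymx_row_norm (C : numClosedFieldType) (n : nat) (W : 'M[C]_n) i :
  W \is unitarymx -> \sum_k `|W i k| ^+ 2 = 1.
Proof.
move=> /unitarymxP/matrixP/(_ i i); rewrite !mxE eqxx mulr1n => <-.
by apply: eq_bigr => k _; rewrite !mxE normCK.
Qed.

Lemma unitarymx_norm_le1 (C : numClosedFieldType) (n : nat) (W : 'M[C]_n) i k :
  W \is unitarymx -> `|W i k| <= 1.
Proof.
move=> Wu; rewrite -(expr_le1 (n := 2))// -(unitarymx_row_norm i Wu).
by rewrite (bigD1 k)//= lerDl sumr_ge0// => l _; rewrite exprn_ge0.
Qed.

(** The l1 norm of row i: it dominates the entries of row i of A U for every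
    unitary U, see mulmx_unitary_le, whence uniform bounds as U varies. *)
Definition rownorm (R : realType) (n : nat) (A : 'M[R[i]]_n) i : R :=
  \sum_k complex.Re `|A i k|.

Lemma rownorm_ge0 (R : realType) (n : nat) (A : 'M[R[i]]_n) i : 0 <= rownorm A i.
Proof.
apply: sumr_ge0 => k _; rewrite -ler0c RRe_real ?normr_real//.
Qed.

Lemma mulmx_unitary_le (R : realType) (n : nat) (A U : 'M[R[i]]_n) i k :
  U \is unitarymx -> `|(A *m U) i k| <= (rownorm A i)%:C.
Proof.
move=> Uu; rewrite mxE; apply: le_trans (ler_norm_sum _ _ _) _.
rewrite /rownorm realc_sum; apply: ler_sum => l _.
rewrite RRe_real ?normr_real// normrM ler_piMr//.
exact: unitarymx_norm_le1.
Qed.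

(** Write M for the left-hand side and N for the first summand on the right.
    U diagonalizes M and V diagonalizes N, so the (i, k) entry of
    V (M - N) U^dag is (V U^dag)_ik (m_k - nu_i); but M - N = t B.  Thus an
    eigenvector of M overlaps with those of N only up to O(t), unless the
    eigenvalues are close. *)
Lemma overlap_le (R : realType) (n : nat) (U V B : 'M[R[i]]_n)
    (m nu : 'I_n -> R) (t : R) i k :
  U \is unitarymx -> V \is unitarymx ->
  U^t* *m realdiag m *m U = V^t* *m realdiag nu *m V + t%:C *: B ->
  `|(V *m U^t*) i k| * `|m k - nu i|%:C <= (`|t| * rownorm (V *m B) i)%:C.
Proof.
move=> Uu Vu E; rewrite -normc_real -normrM.
have -> : (V *m U^t*) i k * (m k - nu i)%:C = t%:C * (V *m B *m U^t*) i k.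
  have e1 : V *m (U^t* *m realdiag m *m U) *m U^t* = V *m U^t* *m realdiag m.
    by rewrite -!mulmxA (unitarymxP Uu) mulmx1.
  have e2 : V *m (V^t* *m realdiag nu *m V) *m U^t* = realdiag nu *m (V *m U^t*).
    by rewrite !mulmxA (unitarymxP Vu) mul1mx.
  have := congr1 (fun X => V *m X *m U^t*) E; rewrite mulmxDr mulmxDl e1 e2.
  rewrite -scalemxAr -scalemxAl => /matrixP/(_ i k).
  rewrite realdiag_mulr [RHS]mxE realdiag_mull [X in _ + X]mxE => e3.
  rewrite rmorphB/= mulrBr e3.
  by rewrite [X in _ - X]mulrC addrAC subrr add0r.
rewrite normrM normc_real rmorphM ler_wpM2l ?ler0c//.
exact: mulmx_unitary_le (unitarymx_adj Uu).
Qed.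

(** * First-order expansion of matrix powers *)

Lemma perturbation_adj (R : realType) (n : nat) (V : 'M[R[i]]_n) (nu : 'I_n -> R)
    (B : 'M[R[i]]_n) (t : R) : B^t* = B ->
  (V^t* *m realdiag nu *m V + t%:C *: B)^t* = V^t* *m realdiag nu *m V + t%:C *: B.
Proof.
by move=> Bh; rewrite adjD adjZ !adjM trmxCK realdiag_adj Bh mulmxA conj_realc.
Qed.

(** Each eigenvector of M is a unit vector, so the overlaps bounded by overlap_le
    cannot all be small: every eigenvalue of M is O(|t|)-close to some nu_i.
    Hence, for small t, all of them stay in one compact interval of positive
    reals. *)
Lemma eigval_near (R : realType) (n : nat) (V : 'M[R[i]]_n) (nu : 'I_n -> R)
    (B : 'M[R[i]]_n) :
  V \is unitarymx -> (forall i, 0 < nu i) -> B^t* = B ->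
  exists c d e, [/\ 0 < c, 0 < e, forall i, c <= nu i <= d &
    forall t, `|t| < e ->
      forall k, c <= eigval (V^t* *m realdiag nu *m V + t%:C *: B) k <= d].
Proof.
move=> Vu nu0 Bh.
(* Bounds 2 c <= nu i <= d - c that make sense also for n = 0. *)
pose S := 1 + \sum_i (nu i)^-1.
have Sge i : (nu i)^-1 <= S.
  rewrite /S (bigD1 i)//= addrCA lerDl addr_ge0//.
  by apply: sumr_ge0 => j _; rewrite invr_ge0 ltW.
have S0 : 0 < S.
  by rewrite ltr_pwDl// sumr_ge0// => j _; rewrite invr_ge0 ltW.
pose c := S^-1 / 2; have c0 : 0 < c by rewrite divr_gt0// invr_gt0.
have cnu i : c + c <= nu i.
  by rewrite -splitr -(invrK (nu i)) lef_pV2// posrE ?invr_gt0.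
pose d := c + \sum_i nu i.
have dnu i : nu i + c <= d.
  rewrite addrC lerD2l (bigD1 i)//= lerDl.
  by apply: sumr_ge0 => j _; rewrite ltW.
pose b := 1 + \sum_i rownorm (V *m B) i.
have b0 : 0 < b by rewrite ltr_pwDl// sumr_ge0// => j _; exact: rownorm_ge0.
exists c, d, (c / b); split=> //; first by rewrite divr_gt0.
  by move=> i; have := cnu i; have := dnu i; lra.
move=> t tlt k; set M := (X in eigval X).
have Mh : M^t* = M by exact: perturbation_adj.
set U := spectralmx M; have Uu : U \is unitarymx := spectral_unitarymx M.
set W := V *m U^t*.
have Wsum : 1 <= \sum_i `|W i k|.
  have Wu : W^t* \is unitarymx.
    exact: unitarymx_adj (mul_unitarymx Vu (unitarymx_adj Uu)).
  rewrite -(unitarymx_row_norm k Wu); apply: ler_sum => i _.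
  have Wle : `|W^t* k i| <= 1 by exact: unitarymx_norm_le1.
  have -> : `|W i k| = `|W^t* k i| by rewrite [in RHS]mxE [in RHS]mxE norm_conjC.
  by rewrite expr2 ler_piMl.
have over i : `|W i k| * `|eigval M k - nu i|%:C <= (`|t| * rownorm (V *m B) i)%:C.
  by apply: (@overlap_le _ _ _ _ _ (eigval M)) => //; rewrite -hermitian_spectral.
(* If every nu i were at distance at least c from the k-th eigenvalue, then the
   total overlap, which is at least 1, would contradict |t| < c / b. *)
apply: contraTT tlt => far; rewrite -leNgt ler_pdivrMr//.
have {}far i : c <= `|eigval M k - nu i|.
  have := cnu i; have := dnu i; move: far; rewrite negb_and -!ltNge => /orP[] h.
  - by move=> _ h'; rewrite ler_normr; apply/orP; right; lra.
  - by move=> h' _; rewrite ler_normr; apply/orP; left; lra.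
apply: (@le_trans _ _ (`|t| * \sum_i rownorm (V *m B) i)); last first.
  by rewrite ler_wpM2l// lerDr.
rewrite -lecR mulr_sumr realc_sum.
apply: (@le_trans _ _ (\sum_i `|W i k| * c%:C)).
  by rewrite -mulr_suml ler_peMl// ler0c ltW.
apply: ler_sum => i _; apply: le_trans (over i).
by rewrite ler_wpM2l// lecR.
Qed.

(** Let r(x) be x^s minus its linear interpolation at the nodes nu_i and nu_j.
    The error in the (i, j) entry is sum_k W_ik r(m_k) conj(W_jk), where the m_k
    are the eigenvalues of M and W is the overlap matrix of the two eigenbases,
    and |r(x)| is bounded by a constant times |x - nu_i| |x - nu_j|.  Each of
    the two factors is absorbed by one overlap and contributes a power of t. *)
Lemma mxpow_first_order (R : realType) (n : nat) (V : 'M[R[i]]_n) (nu : 'I_n -> R)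
    (B : 'M[R[i]]_n) (s : R) :
  V \is unitarymx -> (forall i, 0 < nu i) -> B^t* = B ->
  exists e K, [/\ 0 < e, 0 <= K & forall t, `|t| < e ->
    forall i j, `|(V *m mxpow (V^t* *m realdiag nu *m V + t%:C *: B) s *m V^t*) i j
        - (realdiag (fun k => nu k `^ s) i j
           + (t * powR_divdiff s (nu i) (nu j))%:C * (V *m B *m V^t*) i j)|
      <= (K * t ^+ 2)%:C].
Proof.
move=> Vu nu0 Bh.
have [c [d [e [c0 e0 nuI eigI]]]] := eigval_near Vu nu0 Bh.
have /choice[K0 K0P] : forall ij : 'I_n * 'I_n, exists K, 0 <= K /\
    forall x, c <= x <= d ->
    `|x `^ s - nu ij.2 `^ s - powR_divdiff s (nu ij.1) (nu ij.2) * (x - nu ij.2)|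
      <= K * (`|x - nu ij.1| * `|x - nu ij.2|).
  move=> [i j] /=; have [K K0 KP] := powR_newton_bound s c0 (nuI j) (nuI i).
  by exists K.
pose r := rownorm (V *m B).
have r0 i : 0 <= r i := rownorm_ge0 _ _.
pose Kij ij := n%:R * (K0 ij * (r ij.1 * r ij.2)).
have Kij0 ij : 0 <= Kij ij.
  by rewrite mulr_ge0// mulr_ge0 ?(K0P ij).1// mulr_ge0.
exists e, (\sum_ij Kij ij); split=> //; first exact: sumr_ge0.
move=> t te i j; set M := V^t* *m _ *m _ + _.
have Mh : M^t* = M by exact: perturbation_adj.
set U := spectralmx M; have Uu : U \is unitarymx := spectral_unitarymx M.
set W := V *m U^t*; set m := eigval M.
have over l k : `|W l k| * `|m k - nu l|%:C <= (`|t| * r l)%:C.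
  by apply: overlap_le => //; rewrite -hermitian_spectral.
have spec (g : 'I_n -> R) :
    (V *m (U^t* *m realdiag g *m U) *m V^t*) i j =
    \sum_k W i k * (g k)%:C * Num.conj (W j k).
  rewrite !mulmxA -mulmxA -/W.
  have -> : U *m V^t* = W^t* by rewrite adjM trmxCK.
  rewrite mxE; apply: eq_bigr => k _; rewrite realdiag_mulr.
  by rewrite [_^t* _ _]mxE [_^T _ _]mxE.
have E1 : (V *m mxpow M s *m V^t*) i j =
    \sum_k W i k * (m k `^ s)%:C * Num.conj (W j k).
  by rewrite mxpowE spec.
have diagE g : realdiag g i j = \sum_k W i k * (g j)%:C * Num.conj (W j k).
  have /matrixP/(_ i j) : W *m W^t* = 1%:M.
    exact: (unitarymxP (mul_unitarymx Vu (unitarymx_adj Uu))).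
  rewrite mxE => WW; under eq_bigr do rewrite mulrAC.
  rewrite -mulr_suml; have -> : \sum_k W i k * Num.conj (W j k) = 1%:M i j.
    by rewrite -WW; apply: eq_bigr => k _; rewrite [_^t* _ _]mxE [_^T _ _]mxE.
  by rewrite !mxE; case: (eqVneq i j) => [->|_]; rewrite ?mul1r ?mul0r.
have E2 : t%:C * (V *m B *m V^t*) i j =
    \sum_k W i k * (m k - nu j)%:C * Num.conj (W j k).
  have -> : t%:C * (V *m B *m V^t*) i j =
      (V *m M *m V^t*) i j - realdiag nu i j.
    rewrite /M mulmxDr mulmxDl !mulmxA (unitarymxP Vu) mul1mx -(mulmxA (realdiag _)).
    rewrite (unitarymxP Vu) mulmx1 -scalemxAr -scalemxAl [in RHS]mxE addrAC subrr.
    by rewrite add0r [in RHS]mxE.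
  rewrite {1}(hermitian_spectral Mh) spec diagE -sumrB.
  by apply: eq_bigr => k _; rewrite rmorphB/= mulrBr mulrBl.
have -> : (t * powR_divdiff s (nu i) (nu j))%:C * (V *m B *m V^t*) i j =
    \sum_k W i k * (powR_divdiff s (nu i) (nu j) * (m k - nu j))%:C * Num.conj (W j k).
  rewrite mulrC rmorphM/= mulrA mulrC (mulrC _ t%:C) E2 mulr_sumr.
  by apply: eq_bigr => k _; rewrite rmorphM/=; ring.
rewrite E1 diagE opprD addrA -!sumrB.
apply: le_trans (ler_norm_sum _ _ _) _.
apply: (@le_trans _ _ (\sum_(k < n) (K0 (i, j) * (`|t| * r i * (`|t| * r j)))%:C)).
  apply: ler_sum => k _; rewrite -!mulrBl -!mulrBr -!rmorphB/= !normrM norm_conjC.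
  rewrite normc_real; have := (K0P (i, j)).2 (m k) (eigI t te k).
  rewrite -lecR => /= h; have Wjk0 := normr_ge0 (W j k).
  rewrite mulrAC; apply: le_trans (ler_wpM2l _ h) _; first by rewrite mulr_ge0.
  set a := `|_ - nu i|; set b := `|_ - nu j|; set K := K0 _.
  have -> : `|W i k| * `|W j k| * (K * (a * b))%:C =
      K%:C * (`|W i k| * a%:C * (`|W j k| * b%:C)) by rewrite !rmorphM/=; ring.
  rewrite rmorphM/= ler_wpM2l ?ler0c ?(K0P (i, j)).1// rmorphM/=.
  by apply: ler_pM (over _ _) (over _ _); rewrite mulr_ge0// ler0c.
rewrite -realc_sum sumr_const card_ord lecR -mulr_natl.
have -> : n%:R * (K0 (i, j) * (`|t| * r i * (`|t| * r j))) = Kij (i, j) * t ^+ 2.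
  by rewrite -(normr_idP (sqr_ge0 t)) normrX /Kij/=; ring.
rewrite ler_wpM2r ?sqr_ge0// (bigD1 (i, j))//= lerDl.
by apply: sumr_ge0.
Qed.

(** * Expansion of traces of matrix powers *)

Lemma mxtrace_unitary_conj (C : numClosedFieldType) (n : nat) (V A B : 'M[C]_n) :
  V \is unitarymx ->
  \tr (A *m B) = \tr (V *m A *m V^t* *m (V *m B *m V^t*)).
Proof.
move=> Vu; have VV := unitarymx_adjl Vu.
rewrite !mulmxA -[X in _ = \tr (X *m _ *m _)]mulmxA VV mulmx1.
by rewrite [RHS]mxtrace_mulC !mulmxA VV mul1mx.
Qed.

Lemma mxtrace_unitary1 (C : numClosedFieldType) (n : nat) (V A : 'M[C]_n) :
  V \is unitarymx -> \tr (V *m A *m V^t*) = \tr A.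
Proof. by move=> Vu; rewrite mxtrace_mulC mulmxA (unitarymx_adjl Vu) mul1mx. Qed.

Lemma mxtrace_mul_cycle (C : comNzRingType) (n : nat) (A B D E : 'M[C]_n) :
  \tr (A *m B *m D *m E) = \tr (B *m (D *m E *m A)).
Proof. by rewrite -!mulmxA mxtrace_mulC -!mulmxA. Qed.

Lemma mxtrace_mul (C : comNzRingType) (n : nat) (A B : 'M[C]_n) :
  \tr (A *m B) = \sum_ij A ij.1 ij.2 * B ij.2 ij.1.
Proof.
rewrite -(pair_bigA _ (fun i j => A i j * B j i))/=.
by apply: eq_bigr => i _; rewrite mxE.
Qed.

Lemma norm_Re_le (R : realType) (z : R[i]) a : `|z| <= a%:C -> `|complex.Re z| <= a.
Proof. by move=> za; rewrite -lecR; apply: le_trans (normc_ge_Re z) za. Qed.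

Lemma Re_add (R : realType) (x y : R[i]) :
  complex.Re (x + y) = complex.Re x + complex.Re y.
Proof. by case: x y => [a b] [c d]. Qed.

Lemma Re_opp (R : realType) (x : R[i]) : complex.Re (- x) = - complex.Re x.
Proof. by case: x. Qed.

Lemma trace_mxpow_first_order (R : realType) (n : nat) (V : 'M[R[i]]_n)
    (nu : 'I_n -> R) (B D : 'M[R[i]]_n) (s : R) :
  V \is unitarymx -> (forall i, 0 < nu i) -> B^t* = B ->
  forall B' D', B' = V *m B *m V^t* -> D' = V *m D *m V^t* ->
  exists e K, [/\ 0 < e, 0 <= K & forall t, `|t| < e ->
    `|complex.Re (\tr (mxpow (V^t* *m realdiag nu *m V + t%:C *: B) s *m D))
      - (\sum_i nu i `^ s * complex.Re (D' i i)
         + t * \sum_ij powR_divdiff s (nu ij.1) (nu ij.2)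
                       * complex.Re (B' ij.1 ij.2 * D' ij.2 ij.1))|
      <= K * t ^+ 2].
Proof.
move=> Vu nu0 Bh B' D' B'E D'E.
have [e [K [e0 K0 KP]]] := mxpow_first_order s Vu nu0 Bh.
rewrite -B'E in KP.
pose S := \sum_ij complex.Re `|D' ij.2 ij.1|.
have absE (z : R[i]) : (complex.Re `|z|)%:C = `|z| :> R[i].
  by rewrite RRe_real ?normr_real.
exists e, (K * S); split=> // [|t te].
  by rewrite mulr_ge0// sumr_ge0// => ij _; rewrite -ler0c absE.
have {}KP := KP t te; rewrite (mxtrace_unitary_conj _ _ Vu) mxtrace_mul -D'E.
set F := V *m _ *m V^t* in KP *.
pose F1 ij := realdiag (fun k => nu k `^ s) ij.1 ij.2 +
  (t * powR_divdiff s (nu ij.1) (nu ij.2))%:C * B' ij.1 ij.2.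
have -> : \sum_i nu i `^ s * complex.Re (D' i i) +
   t * (\sum_ij powR_divdiff s (nu ij.1) (nu ij.2) *
                complex.Re (B' ij.1 ij.2 * D' ij.2 ij.1)) =
   complex.Re (\sum_ij F1 ij * D' ij.2 ij.1).
  under [X in complex.Re X]eq_bigr do rewrite mulrDl.
  rewrite big_split Re_add; congr (_ + _).
    rewrite -(mxtrace_mul (realdiag (fun k => nu k `^ s))) Re_sum.
    by apply: eq_bigr => i _; rewrite realdiag_mull Re_realM.
  rewrite Re_sum mulr_sumr; apply: eq_bigr => ij _.
  by rewrite -mulrA Re_realM mulrA.
rewrite -Re_opp -Re_add; apply: norm_Re_le; rewrite -sumrB.
apply: le_trans (ler_norm_sum _ _ _) _.
rewrite mulrAC rmorphM/= realc_sum mulr_sumr; apply: ler_sum => -[i j] _ /=.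
by rewrite -mulrBl normrM absE ler_wpM2r.
Qed.

Lemma is_derive_quadratic (R : realType) (f : R -> R) (x l e K : R) : 0 < e ->
  (forall h, `|h| < e -> `|f (x + h) - (f x + h * l)| <= K * h ^+ 2) ->
  is_derive x 1 f l.
Proof.
move=> e0 fP.
have lim : h^-1 *: (f (h *: 1 + x) - f x) @[h --> 0^'] --> l.
  apply/cvgrPdist_le => /= eta eta0; near=> h.
  have h0 : h != 0 by near: h; exact: nbhs_dnbhs_neq.
  have he : `|h| < e.
    near: h; apply: dnbhs0_lt; exact: e0.
  have hK : `|h| <= eta / (`|K| + 1).
    by near: h; apply: dnbhs0_le; rewrite divr_gt0.
  rewrite ler_pdivlMr in hK; last by rewrite ltr_wpDl.
  have -> : l - h^-1 *: (f (h *: 1 + x) - f x) =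
      - h^-1 * (f (x + h) - (f x + h * l)).
    by rewrite scaler1 (addrC h) /GRing.scale/=; field.
  rewrite normrM normrN normfV ler_pdivrMl ?normr_gt0//.
  apply: le_trans (fP h he) _.
  apply: (@le_trans _ _ (`|h| * (`|h| * (`|K| + 1)))); last by rewrite ler_wpM2l.
  rewrite mulrA -expr2 real_normK ?num_real// mulrC ler_wpM2l ?sqr_ge0//.
  by apply: le_trans (ler_norm K) _; rewrite lerDl.
split; last exact/cvg_lim.
by apply/cvg_ex; exists l.
Unshelve. all: by end_near. Qed.

(** trace_mxpow_first_order is applied at the base point N, diagonalized in its
    own eigenbasis.  Only diagonal entries survive in the trace, and there
    the divided difference is the derivative s x^(s-1). *)
Lemma trace_mxpow_differential (R : realType) (n : nat) (N B : 'M[R[i]]_n) (s : R) :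
  N^t* = N -> (forall k, 0 < eigval N k) -> B^t* = B ->
  exists e K, [/\ 0 < e, 0 <= K & forall h, `|h| < e ->
    `|complex.Re (\tr (mxpow (N + h%:C *: B) s))
      - (complex.Re (\tr (mxpow N s))
         + h * (s * complex.Re (\tr (mxpow N (s - 1) *m B))))| <= K * h ^+ 2].
Proof.
move=> Nh m0 Bh; have NE := hermitian_spectral Nh; set U := spectralmx N in NE.
have Uu : U \is unitarymx := spectral_unitarymx _.
have U1 : 1%:M = U *m 1%:M *m U^t* by rewrite mulmx1 (unitarymxP Uu).
have := trace_mxpow_first_order s Uu m0 Bh erefl U1; rewrite -NE.
have -> : \sum_i eigval N i `^ s * complex.Re ((1%:M : 'M[R[i]]_n) i i) =
    complex.Re (\tr (mxpow N s)).
  rewrite mxpowE -/U mxtrace_mulC mulmxA (unitarymxP Uu) mul1mx Re_sum.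
  by apply: eq_bigr => i _; rewrite !mxE eqxx /= mulr1.
set tr1 := \sum_ij _; suff -> : tr1 = s * complex.Re (\tr (mxpow N (s - 1) *m B)).
  move=> [e [K [e0 K0 KP]]]; exists e, K; split=> // h he.
  by rewrite -(mulmx1 (mxpow (N + _) s)); exact: KP h he.
rewrite /tr1 mxpowE -/U mxtrace_mul_cycle.
move: (U *m B *m U^t*) => B'; rewrite Re_sum mulr_sumr.
rewrite -(pair_bigA _ (fun i j => powR_divdiff s (eigval N i) (eigval N j) *
  complex.Re (B' i j * (1%:M : 'M[R[i]]_n) j i)))/=.
apply: eq_bigr => i _; rewrite (bigD1 i)//= big1 ?addr0 => [|j ji].
  have -> : (1%:M : 'M[R[i]]_n) i i = 1 by rewrite mxE eqxx.
  by rewrite mulr1 realdiag_mull Re_realM mulrA /powR_divdiff eqxx.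
have -> : (1%:M : 'M[R[i]]_n) j i = 0 by rewrite mxE (negPf ji).
by rewrite !mulr0.
Qed.

Lemma is_derive_trace_mxpow (R : realType) (n : nat) (V : 'M[R[i]]_n)
    (nu : 'I_n -> R) (B : 'M[R[i]]_n) (s : R) :
  V \is unitarymx -> (forall i, 0 < nu i) -> B^t* = B ->
  let M (t : R) := V^t* *m realdiag nu *m V + t%:C *: B in
  exists2 e : R, 0 < e & forall t : R, `|t| < e ->
    is_derive t 1 (fun t => complex.Re (\tr (mxpow (M t) s)))
      (s * complex.Re (\tr (mxpow (M t) (s - 1) *m B))).
Proof.
move=> Vu nu0 Bh M.
have [c [d [e [c0 e0 _ eigI]]]] := eigval_near Vu nu0 Bh.
exists e => // t te; have Mh : (M t)^t* = M t by exact: perturbation_adj.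
have m0 k : 0 < eigval (M t) k.
  by apply: lt_le_trans c0 _; have /andP[] := eigI t te k.
have [e' [K [e'0 K0 KP]]] := trace_mxpow_differential s Mh m0 Bh.
pose g u := complex.Re (\tr (mxpow (M u) s)).
apply: (@is_derive_quadratic _ g t _ e' K e'0) => h he.
have Mth : M (t + h) = M t + h%:C *: B by rewrite /M rmorphD/= scalerDl addrA.
by rewrite /g Mth; exact: KP h he.
Qed.

(** By the mean value theorem, the remainder at t is t times the first-order
    remainder of s tr (M^(s-1) B) at an intermediate point. *)
Lemma trace_mxpow_second_order (R : realType) (n : nat) (V : 'M[R[i]]_n)
    (nu : 'I_n -> R) (B : 'M[R[i]]_n) (s : R) :
  V \is unitarymx -> (forall i, 0 < nu i) -> B^t* = B ->
  forall B', B' = V *m B *m V^t* ->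
  exists e K, [/\ 0 < e, 0 <= K & forall t, 0 < t < e ->
    `|complex.Re (\tr (mxpow (V^t* *m realdiag nu *m V + t%:C *: B) s))
      - (\sum_i nu i `^ s + t * (s * \sum_i nu i `^ (s - 1) * complex.Re (B' i i))
         + t ^+ 2 / 2 * (s * \sum_ij powR_divdiff (s - 1) (nu ij.1) (nu ij.2)
                       * complex.Re (B' ij.1 ij.2 * B' ij.2 ij.1)))|
      <= K * t ^+ 3].
Proof.
move=> Vu nu0 Bh B' B'E.
have [e1 e10 der] := is_derive_trace_mxpow s Vu nu0 Bh.
have [e2 [K [e20 K0 KP]]] :=
  trace_mxpow_first_order (s - 1) Vu nu0 Bh B'E B'E.
pose M (t : R) := V^t* *m realdiag nu *m V + t%:C *: B.
set G0 := \sum_i _ `^ (s - 1) * _ in KP *.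
set D1 := \sum_ij powR_divdiff _ _ _ * _ in KP *.
pose g (t : R) := complex.Re (\tr (mxpow (M t) s)).
pose phi (t : R) := g t - (t * (s * G0) + t ^+ 2 / 2 * (s * D1)).
pose dphi (t : R) :=
  s * complex.Re (\tr (mxpow (M t) (s - 1) *m B)) - (s * G0 + t * (s * D1)).
have dphiP t : `|t| < e1 -> is_derive t (1 : R) phi (dphi t).
  move=> te; have dg : is_derive t 1 g _ := der t te.
  suff dq : is_derive t (1 : R) (fun t : R => t * (s * G0) + t ^+ 2 / 2 * (s * D1))
      (s * G0 + t * (s * D1)) by exact: is_deriveB.
  apply: is_derive_eq; rewrite /GRing.scale/=. by field.
have g0 : g 0 = \sum_i nu i `^ s.
  have [e3 [K3 [e30 _ K3P]]] := mxpow_first_order s Vu nu0 Bh.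
  have := K3P 0; rewrite normr0 expr0n mulr0 => /(_ e30) K30.
  rewrite /g -(mxtrace_unitary1 _ Vu) Re_sum; apply: eq_bigr => i _.
  have := K30 i i; rewrite mul0r mul0r addr0 normr_le0 subr_eq0 => /eqP; rewrite /M => ->.
  by rewrite !mxE eqxx.
pose e := Num.min e1 e2; exists e; exists (`|s| * K); split.
- by rewrite /e lt_min e10.
- by rewrite mulr_ge0.
move=> t /andP[t0]; rewrite /e lt_min => /andP[te1 te2].
have tnorm u : 0 <= u <= t -> `|u| < e1 /\ `|u| < e2.
  by move=> /andP[u0 ut]; rewrite ger0_norm// !(le_lt_trans ut).
have der' u : u \in `]0, t[%R -> is_derive u 1 phi (dphi u).
  rewrite in_itv/= => /andP[u0 ut]; apply: dphiP.
  by apply: (tnorm _ _).1; rewrite !ltW.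
have cont : {within `[0, t], continuous phi}.
  apply: continuous_in_subspaceT => u; rewrite inE/= in_itv/= => uI.
  apply: differentiable_continuous; apply/derivable1_diffP.
  by have [] := dphiP u (tnorm u uI).1.
have [u + mvt] := MVT t0 der' cont; rewrite in_itv/= => /andP[u0 ut].
rewrite -g0 -/(M t) -/(g t).
have -> : g t - (g 0 + t * (s * G0) + t ^+ 2 / 2 * (s * D1)) = dphi u * t.
  by rewrite subr0 in mvt; rewrite -mvt /phi; move: (g t) (g 0) => gt gz; ring.
rewrite normrM (gtr0_norm t0) exprSr mulrA ler_wpM2r ?(ltW t0)//.
have -> : dphi u = s * (complex.Re (\tr (mxpow (M u) (s - 1) *m B)) - (G0 + u * D1)).
  by rewrite /dphi; move: (complex.Re _) => x; ring.
rewrite normrM -[leRHS]mulrA ler_wpM2l//.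
apply: le_trans (KP u _) _; first by apply: (tnorm _ _).2; rewrite !ltW.
by rewrite ler_wpM2l// ler_sqr ?nnegrE ltW.
Qed.

(** * Generators of quantum Markov semigroups *)

Lemma qform_realdiag (R : realType) (n : nat) (U : 'M[R[i]]_n) (g : 'I_n -> R)
    (v : 'cV[R[i]]_n) :
  (v^t* *m (U^t* *m realdiag g *m U) *m v) 0 0 =
  \sum_k (g k)%:C * `|(U *m v) k 0| ^+ 2.
Proof.
have -> : v^t* *m (U^t* *m realdiag g *m U) *m v =
   (U *m v)^t* *m (realdiag g *m (U *m v)) by rewrite adjM !mulmxA.
rewrite mxE; apply: eq_bigr => k _; rewrite realdiag_mull.
by rewrite [_^t* _ _]mxE [_^T _ _]mxE normCK; ring.
Qed.

Lemma psdmx_gram (R : realType) (m n : nat) (G : 'M[R[i]]_(m, n)) :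
  psdmx (G^t* *m G).
Proof.
move=> v; have -> : v^t* *m (G^t* *m G) *m v = (G *m v)^t* *m (G *m v).
  by rewrite adjM !mulmxA.
rewrite mxE sumr_ge0// => k _; rewrite [_^t* _ _]mxE [_^T _ _]mxE mulrC.
by rewrite -normCK exprn_ge0.
Qed.

Lemma qform_delta (C : numClosedFieldType) (n : nat) (A : 'M[C]_n) j k :
  ((delta_mx j 0 : 'cV[C]_n)^t* *m A *m (delta_mx k 0 : 'cV[C]_n)) 0 0 = A j k.
Proof.
have -> : (delta_mx j 0 : 'cV[C]_n)^t* = delta_mx 0 j.
  apply/matrixP => a b; rewrite !mxE andbC.
  by case: (_ && _); rewrite ?rmorph1 ?rmorph0.
by rewrite -rowE -colE !mxE.
Qed.

(** Polarization: with c = 1 and c = i this recovers the sesquilinear form from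
    the quadratic form. *)
Lemma qform_expand (C : numClosedFieldType) (n : nat) (A : 'M[C]_n) (u v : 'cV[C]_n) c :
  ((u + c *: v)^t* *m A *m (u + c *: v)) 0 0 =
  (u^t* *m A *m u) 0 0 + c * (u^t* *m A *m v) 0 0 +
  Num.conj c * ((v^t* *m A *m u) 0 0 + c * (v^t* *m A *m v) 0 0).
Proof.
rewrite adjD adjZ mulmxDl mulmxDl !mulmxDr -!scalemxAl -!scalemxAr.
move: (u^t* *m A *m u) (u^t* *m A *m v) (v^t* *m A *m u) (v^t* *m A *m v).
by move=> uu uv vu vv; rewrite !mxE; ring.
Qed.

Lemma qform_real_adj (C : numClosedFieldType) (n : nat) (A : 'M[C]_n) :
  (forall v : 'cV[C]_n, (v^t* *m A *m v) 0 0 \is Num.real) -> A^t* = A.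
Proof.
move=> Areal; apply/matrixP => j k; rewrite [LHS]mxE [_^T _ _]mxE.
have q_conj (v : 'cV[C]_n) :
    Num.conj ((v^t* *m A *m v) 0 0) = (v^t* *m A *m v) 0 0.
  exact: conj_Creal (Areal v).
pose e l : 'cV[C]_n := delta_mx l 0.
have qE c : ((e j + c *: e k)^t* *m A *m (e j + c *: e k)) 0 0 =
    A j j + c * A j k + Num.conj c * (A k j + c * A k k).
  rewrite (qform_expand A (e j)) (qform_delta A j j) (qform_delta A j k).
  by rewrite (qform_delta A k j) (qform_delta A k k).
have hd l : Num.conj (A l l) = A l l by rewrite -(qform_delta A l l); exact: q_conj.
have h1 := q_conj (e j + 'i%R *: e k); have h2 := q_conj (e j + 1 *: e k).
rewrite (qE 'i%R) in h1; rewrite (qE 1) in h2; move: h1 h2.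
have := hd j; have := hd k; have i0 : ('i%R : C) != 0 by exact: neq0Ci.
move: (A j k) (A k j) (A j j) (A k k) => jk kj jj kk hk hj.
rewrite !rmorphD/= !rmorphM/= !rmorphD/= !rmorphM/= !rmorph1 !conjCK conjCi hk hj.
move: (Num.conj jk) (Num.conj kj) => jk' kj' h1 h2.
have e1 : jk' + kj' - (jk + kj) = 0.
  by move/eqP: h2; rewrite -subr_eq0 => /eqP <-; ring.
have e2 : 'i%R * (kj' - jk' - (jk - kj)) = 0.
  by move/eqP: h1; rewrite -subr_eq0 => /eqP <-; ring.
move/eqP: e2; rewrite mulf_eq0 (negPf i0)/= => /eqP e2.
apply/eqP; rewrite -subr_eq0; apply/eqP.
have : 2 * (kj' - jk) = 0 by rewrite -[RHS]addr0 -{1}e1 -e2; ring.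
by move/eqP; rewrite mulf_eq0 pnatr_eq0/= => /eqP.
Qed.

Lemma psdmx_adj (R : realType) (n : nat) (A : 'M[R[i]]_n) : psdmx A -> A^t* = A.
Proof. by move=> Apsd; apply: qform_real_adj => v; apply: ger0_real. Qed.

Lemma psdmx_eigval_ge0 (R : realType) (n : nat) (A : 'M[R[i]]_n) k :
  psdmx A -> 0 <= eigval A k.
Proof.
move=> Apsd; have Ah := psdmx_adj Apsd.
have := Apsd ((spectralmx A)^t* *m delta_mx k 0); rewrite {2}(hermitian_spectral Ah).
rewrite qform_realdiag mulmxA (unitarymxP (spectral_unitarymx _)) mul1mx.
rewrite (bigD1 k)//= big1 ?addr0 => [|l lk].
  by rewrite !mxE !eqxx normr1 expr1n mulr1 ler0c.
by rewrite !mxE (negPf lk) normr0 expr0n mulr0.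
Qed.

(** If A = G^dag G, then the block matrix with all blocks A is the Gram matrix
    of the block row (G ... G). *)
Lemma mxblock_const_psd (R : realType) (n : nat) (A : 'M[R[i]]_n) k : psdmx A ->
  psdmx (\mxblock_(i < k, j < k) A).
Proof.
move=> Apsd; have Ah := psdmx_adj Apsd.
set U := spectralmx A; have Uu : U \is unitarymx := spectral_unitarymx A.
pose G := realdiag (fun l => Num.sqrt (eigval A l)) *m U.
have AG : A = G^t* *m G.
  rewrite {1}(hermitian_spectral Ah) adjM realdiag_adj !mulmxA; congr (_ *m _).
  rewrite -mulmxA; congr (_ *m _); apply/matrixP => a b.
  rewrite realdiag_mull !mxE; case: (eqVneq a b) => [->|_].
    by rewrite -rmorphM/= -expr2 sqr_sqrtr// psdmx_eigval_ge0.
  by rewrite mulr0.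
have -> : \mxblock_(i < k, j < k) A =
    (\mxrow_(j < k) G)^t* *m (\mxrow_(j < k) G).
  rewrite {1}AG -mul_mxcol_mxrow; congr (_ *m _).
  by apply/matrixP => a b; rewrite !mxE.
exact: psdmx_gram.
Qed.

Lemma psdmx_unitary_realdiag (R : realType) (n : nat) (U : 'M[R[i]]_n)
    (g : 'I_n -> R) : (forall k, 0 <= g k) -> psdmx (U^t* *m realdiag g *m U).
Proof.
move=> g0 v; rewrite qform_realdiag sumr_ge0// => k _.
by rewrite mulr_ge0 ?ler0c ?exprn_ge0.
Qed.

(** Complete positivity is used with a single block. *)
Lemma cp_psd_hermitian (R : realType) (n : nat) (Phi : 'M[R[i]]_n -> 'M[R[i]]_n) A :
  completely_positive Phi -> psdmx A -> (Phi A)^t* = Phi A.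
Proof.
move=> cp /(@mxblock_const_psd _ _ _ 1) /cp /psdmx_adj.
move/(congr1 (fun M => submxblock M ord0 ord0)).
rewrite mxblockK mxblockK => {2}<-.
have -> (M : 'M[R[i]]_(\sum_(i < 1) n)) : submxblock (M^t*) ord0 ord0 =
    (submxblock M ord0 ord0)^t* by apply/matrixP => a b; rewrite !mxE.
by rewrite !mxblockK.
Qed.

Lemma hermitian_preserving_adj (R : realType) (n : nat)
    (Phi : {linear 'M[R[i]]_n -> 'M[R[i]]_n}) :
  (forall H, H^t* = H -> (Phi H)^t* = Phi H) -> forall X, (Phi X)^t* = Phi (X^t*).
Proof.
move=> PhiH X.
have h1 : (Phi (X + X^t*))^t* = Phi (X + X^t*).
  by apply: PhiH; rewrite adjD trmxCK addrC.
have h2 : (Phi ('i%R *: (X - X^t*)))^t* = Phi ('i%R *: (X - X^t*)).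
  apply: PhiH; rewrite adjZ conjCi adjD raddfN/= map_mxN trmxCK.
  by rewrite scaleNr -scalerN opprB.
have i0 : ('i%R : R[i]) != 0 by exact: neq0Ci.
have e1 : Phi (X + X^t*) = Phi X + Phi (X^t*) by rewrite raddfD.
have e2 : Phi ('i%R *: (X - X^t*)) = 'i%R *: (Phi X - Phi (X^t*)).
  by rewrite linearZ/= raddfB.
move: h1 h2; rewrite {}e1 {}e2 adjZ conjCi scaleNr -scalerN adjD => h1.
move=> /(scalerI i0); rewrite adjD !raddfN/= opprD opprK addrC => h2.
move: (Phi X) (Phi (X^t*)) h1 h2 => a b h1 h2.
apply/matrixP => j k.
have /eqP := congr1 (fun M : 'M[R[i]]_n => M j k) h1.
have /eqP := congr1 (fun M : 'M[R[i]]_n => M j k) h2.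
rewrite !mxE -!(subr_eq0 _ (_ + _)) => /eqP k2 /eqP k1.
have : 2 * (Num.conj (a k j) - b j k) = 0 by rewrite -[RHS](subrr 0) -{1}k1 -k2; ring.
by move/eqP; rewrite mulf_eq0 pnatr_eq0/= subr_eq0 => /eqP.
Qed.

(** A Hermitian matrix becomes positive semidefinite after adding a large
    multiple of the identity. *)
Lemma cp_hermitian (R : realType) (n : nat) (Phi : {linear 'M[R[i]]_n -> 'M[R[i]]_n}) H :
  completely_positive Phi -> H^t* = H -> (Phi H)^t* = Phi H.
Proof.
move=> cp Hh; pose c := \sum_k `|eigval H k|.
have HE : H + c%:C%:M =
    (spectralmx H)^t* *m realdiag (fun k => eigval H k + c) *m spectralmx H.
  have -> : realdiag (fun k => eigval H k + c) = realdiag (eigval H) + c%:C%:M.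
    apply/matrixP => a b; rewrite !mxE rmorphD/=.
    by case: (eqVneq a b) => // _; rewrite !mulr0n addr0.
  rewrite mulmxDr mulmxDl -hermitian_spectral// -scalemx1 -scalemxAr mulmx1.
  by rewrite -scalemxAl unitarymx_adjl// spectral_unitarymx.
have psd1 : psdmx (H + c%:C%:M).
  rewrite HE; apply: psdmx_unitary_realdiag => k.
  rewrite -lerBlDl sub0r; apply: le_trans (ler_norm _) _; rewrite normrN.
  by rewrite /c (bigD1 k)//= lerDl sumr_ge0.
have psd2 : psdmx (c%:C%:M : 'M[R[i]]_n).
  have -> : (c%:C%:M : 'M[R[i]]_n) = 1%:M^t* *m realdiag (fun=> c) *m 1%:M.
    rewrite mulmx1 trmx1 map_mx1 mul1mx.
    by apply/matrixP => a b; rewrite !mxE.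
  by apply: psdmx_unitary_realdiag => k; rewrite sumr_ge0.
have := cp_psd_hermitian cp psd1; have := cp_psd_hermitian cp psd2.
by rewrite raddfD/= adjD => -> /addIr.
Qed.

Lemma generator_approx (R : realType) (n : nat)
    (P : R -> {linear 'M[R[i]]_n -> 'M[R[i]]_n})
    (L : {linear 'M[R[i]]_n -> 'M[R[i]]_n}) (X : 'M[R[i]]_n) (eps : R[i]) :
  is_generator P L -> 0 < eps ->
  exists2 t : R, 0 < t &
    forall i j, `|L X i j - (t^-1%:C *: (P t X - X)) i j| < eps.
Proof.
move=> gen eps0.
have /cvg_ballP/(_ _ eps0) near_L := gen X.
have [t [t0 [_ tb]]] := filter_ex (filterI (nbhs_right_gt 0) near_L).
by exists t.
Qed.

Lemma eq0_of_small (R : realType) (z : R[i]) :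
  (forall eps, 0 < eps -> `|z| < eps) -> z = 0.
Proof.
move=> h; apply/eqP; rewrite -normr_eq0; apply: contraT => z0.
by have := h `|z|; rewrite lt_neqAle eq_sym z0 normr_ge0 ltxx => /(_ isT).
Qed.

Lemma generator_unital (R : realType) (n : nat)
    (P : R -> {linear 'M[R[i]]_n -> 'M[R[i]]_n})
    (L : {linear 'M[R[i]]_n -> 'M[R[i]]_n}) :
  is_QMS P -> is_generator P L -> L 1%:M = 0.
Proof.
move=> qms gen; apply/matrixP => i j; rewrite [RHS]mxE; apply: eq0_of_small => eps eps0.
have [t t0 /(_ i j)] := generator_approx 1%:M gen eps0.
by rewrite (qms_unital qms (ltW t0)) subrr scaler0 [X in _ - X]mxE subr0.
Qed.

Lemma generator_adj (R : realType) (n : nat)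
    (P : R -> {linear 'M[R[i]]_n -> 'M[R[i]]_n})
    (L : {linear 'M[R[i]]_n -> 'M[R[i]]_n}) :
  is_QMS P -> is_generator P L -> forall X, (L X)^t* = L (X^t*).
Proof.
move=> qms gen; apply: hermitian_preserving_adj => H Hh; apply/matrixP => i j.
rewrite [LHS]mxE [_^T _ _]mxE; apply/eqP; rewrite -subr_eq0; apply/eqP.
apply: eq0_of_small => eps eps0; have e20 : 0 < eps / 2 by rewrite divr_gt0.
have [t t0 tP] := generator_approx H gen e20.
set F := _ *: _ in tP.
have Fh : Num.conj (F j i) = F i j.
  have {2}<- : F^t* = F.
    rewrite adjZ conj_realc adjD raddfN/= map_mxN Hh.
    by rewrite (cp_hermitian (qms_cp qms (ltW t0)))//.
  by rewrite [in RHS]mxE [_^T _ _]mxE.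
have -> : Num.conj (L H j i) - L H i j =
    Num.conj (L H j i - F j i) - (L H i j - F i j) by rewrite rmorphB/= Fh; ring.
apply: le_lt_trans (ler_normB _ _) _; rewrite norm_conjC [ltRHS]splitr.
by rewrite ltrD.
Qed.

(** * Coordinates in the eigenbasis of the invariant state *)

Definition eigcoord (R : realType) (n : nat) (sigma X : 'M[R[i]]_n) : 'M[R[i]]_n :=
  spectralmx sigma *m X *m (spectralmx sigma)^t*.

Definition of_eigcoord (R : realType) (n : nat) (sigma X : 'M[R[i]]_n) : 'M[R[i]]_n :=
  (spectralmx sigma)^t* *m X *m spectralmx sigma.

Lemma eigcoordK (R : realType) (n : nat) (sigma X : 'M[R[i]]_n) :
  of_eigcoord sigma (eigcoord sigma X) = X.
Proof.
rewrite /of_eigcoord /eigcoord !mulmxA unitarymx_adjl ?spectral_unitarymx//.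
by rewrite mul1mx -mulmxA unitarymx_adjl ?spectral_unitarymx// mulmx1.
Qed.

Lemma of_eigcoordK (R : realType) (n : nat) (sigma X : 'M[R[i]]_n) :
  eigcoord sigma (of_eigcoord sigma X) = X.
Proof.
rewrite /of_eigcoord /eigcoord !mulmxA (unitarymxP (spectral_unitarymx _)).
by rewrite mul1mx -mulmxA (unitarymxP (spectral_unitarymx _)) mulmx1.
Qed.

Lemma eigcoordM (R : realType) (n : nat) (sigma X Y : 'M[R[i]]_n) :
  eigcoord sigma (X *m Y) = eigcoord sigma X *m eigcoord sigma Y.
Proof.
rewrite /eigcoord; set U := spectralmx sigma.
have UU : U^t* *m U = 1%:M by rewrite unitarymx_adjl ?spectral_unitarymx.
by rewrite -[RHS]mulmxA !(mulmxA (U^t*)) UU mul1mx !mulmxA.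
Qed.

Lemma eigcoord_adj (R : realType) (n : nat) (sigma X : 'M[R[i]]_n) :
  eigcoord sigma (X^t*) = (eigcoord sigma X)^t*.
Proof. by rewrite /eigcoord !adjM trmxCK mulmxA. Qed.

Lemma eigcoord_mxpow (R : realType) (n : nat) (sigma : 'M[R[i]]_n) r :
  eigcoord sigma (mxpow sigma r) = realdiag (fun k => eigval sigma k `^ r).
Proof. by rewrite mxpowE; exact: of_eigcoordK. Qed.

Lemma eigcoord_herm (R : realType) (n : nat) (sigma : 'M[R[i]]_n) :
  sigma^t* = sigma -> eigcoord sigma sigma = realdiag (eigval sigma).
Proof.
move=> /hermitian_spectral sE; rewrite -[RHS](of_eigcoordK sigma).
by congr eigcoord.
Qed.

Lemma mxtrace_eigcoord (R : realType) (n : nat) (sigma X : 'M[R[i]]_n) :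
  \tr (eigcoord sigma X) = \tr X.
Proof.
by rewrite /eigcoord mxtrace_mulC mulmxA unitarymx_adjl ?spectral_unitarymx// mul1mx.
Qed.

Lemma eigcoord_inj (R : realType) (n : nat) (sigma : 'M[R[i]]_n) :
  injective (eigcoord sigma).
Proof. exact: can_inj (eigcoordK sigma). Qed.

Lemma psdmx_eigval_gt0 (R : realType) (n : nat) (A : 'M[R[i]]_n) k :
  psdmx A -> \rank A = n -> 0 < eigval A k.
Proof.
move=> Apsd rk; rewrite lt_neqAle psdmx_eigval_ge0// andbT.
have : A \in unitmx by rewrite -row_full_unit /row_full rk.
rewrite {1}(hermitian_spectral (psdmx_adj Apsd)) !unitmx_mul => /andP[/andP[_ + _]].
rewrite unitmxE det_diag unitfE; apply: contraNneq => m0.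
by apply/prodf_eq0; exists k => //; rewrite mxE -m0.
Qed.

Lemma mxpow1 (R : realType) (n : nat) (A : 'M[R[i]]_n) : psdmx A -> mxpow A 1 = A.
Proof.
move=> Apsd; rewrite mxpowE; have -> : (fun k => eigval A k `^ 1) = eigval A.
  by apply/funext => k; rewrite powRr1// psdmx_eigval_ge0.
exact: esym (hermitian_spectral (psdmx_adj Apsd)).
Qed.

Lemma mxpowD (R : realType) (n : nat) (A : 'M[R[i]]_n) r s :
  (forall k, 0 < eigval A k) -> mxpow A r *m mxpow A s = mxpow A (r + s).
Proof.
move=> A0; pose g r := realdiag (fun k => eigval A k `^ r).
have gD : g r *m g s = g (r + s).
  apply/matrixP => a b; rewrite realdiag_mull !mxE; case: (eqVneq a b) => [->|_].
    rewrite powRD ?rmorphM//; apply/implyP => _.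
    by rewrite lt0r_neq0.
  by rewrite mulr0.
apply: (@eigcoord_inj _ _ A); apply: etrans (eigcoordM _ _ _) _.
apply: etrans (congr2 mulmx (eigcoord_mxpow A r) (eigcoord_mxpow A s)) _.
by apply: etrans gD _; exact: esym (eigcoord_mxpow A (r + s)).
Qed.

Lemma posdef_psd (R : realType) (n : nat) (A : 'M[R[i]]_n) : posdefmx A -> psdmx A.
Proof.
move=> A0 v; have [->|/A0/ltW//] := eqVneq v 0.
by rewrite mulmx0 mxE.
Qed.

(** Perturbation of the identity, whose eigenvalues all equal 1: those of
    1 + t B stay positive for small t by eigval_near. *)
Lemma posdefmx_near1 (R : realType) (n : nat) (B : 'M[R[i]]_n) : B^t* = B ->
  exists2 e : R, 0 < e & forall t : R, `|t| < e -> posdefmx (1%:M + t%:C *: B).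
Proof.
move=> Bh; have one_u : (1%:M : 'M[R[i]]_n) \is unitarymx.
  by apply/unitarymxP; rewrite trmx1 map_mx1 mulmx1.
have [c [d [e [c0 e0 _ eigI]]]] :=
  @eigval_near R n 1%:M (fun=> 1) B one_u (fun=> ltr01) Bh.
have oneE : (1%:M : 'M[R[i]]_n)^t* *m realdiag (fun=> 1) *m 1%:M = 1%:M.
  rewrite mulmx1 trmx1 map_mx1 mul1mx.
  by apply/matrixP => a b; rewrite !mxE.
exists e => // t te v v0; have := eigI t te; rewrite oneE.
set M := 1%:M + _ => mI; have Mh : M^t* = M.
  by rewrite /M adjD adjZ conj_realc Bh trmx1 map_mx1.
rewrite {1}(hermitian_spectral Mh) qform_realdiag.
have m0 k : 0 < eigval M k by have /andP[+ _] := mI k; exact: lt_le_trans.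
have : spectralmx M *m v != 0.
  apply: contraNneq v0 => Uv0; rewrite -[v]mul1mx.
  by rewrite -(unitarymx_adjl (spectral_unitarymx M)) -mulmxA Uv0 mulmx0.
move=> /cV0Pn[k wk]; rewrite (bigD1 k)//= ltr_wpDr//.
  by rewrite sumr_ge0// => l _; rewrite mulr_ge0 ?exprn_ge0// ler0c ltW.
by rewrite mulr_gt0 ?exprn_gt0 ?normr_gt0// ltcR.
Qed.

Lemma Gamma_eigcoord (R : realType) (n : nat) (sigma X : 'M[R[i]]_n) r i j :
  eigcoord sigma (Gamma sigma r X) i j =
  (eigval sigma i `^ (r / 2) * eigval sigma j `^ (r / 2))%:C * eigcoord sigma X i j.
Proof.
rewrite /Gamma (eigcoordM sigma (_ *m X)) (eigcoordM sigma _ X).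
rewrite eigcoord_mxpow realdiag_mulr realdiag_mull rmorphM/=.
by ring.
Qed.

Lemma Gamma_adj (R : realType) (n : nat) (sigma X : 'M[R[i]]_n) r :
  (Gamma sigma r X)^t* = Gamma sigma r (X^t*).
Proof. by rewrite /Gamma (adjM (_ *m X)) (adjM _ X) !mxpow_adj mulmxA. Qed.

Lemma Gamma_psd (R : realType) (n : nat) (sigma X : 'M[R[i]]_n) r :
  psdmx X -> psdmx (Gamma sigma r X).
Proof.
move=> Xpsd v; have := Xpsd (mxpow sigma (r / 2) *m v).
by rewrite (adjM _ v) mxpow_adj /Gamma; move: (mxpow _ _) => S; rewrite !mulmxA.
Qed.

(** * The Beckner inequality near the identity *)

(** With x, y eigenvalues of sigma, the divided difference comes from expanding
    the matrix power, at the eigenvalues x^(1/p), y^(1/p) of sigma^(1/p); the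
    squared factor comes from the two occurrences of Gamma^(1/p).  Dividing by
    p - 1 makes the kernel positive on both sides of p = 1. *)
Definition beckner_kernel (R : realType) (p x y : R) : R :=
  powR_divdiff (p - 1) (x `^ p^-1) (y `^ p^-1) / (p - 1)
    * (x `^ (p^-1 / 2) * y `^ (p^-1 / 2)) ^+ 2.

Lemma trace_mxpow_ge0 (R : realType) (n : nat) (M : 'M[R[i]]_n) s :
  0 <= complex.Re (\tr (mxpow M s)).
Proof.
rewrite mxpowE mxtrace_mulC mulmxA (unitarymxP (spectral_unitarymx _)) mul1mx Re_sum.
by apply: sumr_ge0 => k _; rewrite !mxE eqxx /= powR_ge0.
Qed.

Lemma mxtrace_realdiag_mul (R : realType) (n : nat) (m : 'I_n -> R) (A : 'M[R[i]]_n) :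
  complex.Re (\tr (realdiag m *m A)) = \sum_i m i * complex.Re (A i i).
Proof. by rewrite Re_sum; apply: eq_bigr => i _; rewrite realdiag_mull Re_realM. Qed.

Lemma GammaD (R : realType) (n : nat) (sigma X Y : 'M[R[i]]_n) r :
  Gamma sigma r (X + Y) = Gamma sigma r X + Gamma sigma r Y.
Proof. by rewrite /Gamma mulmxDr mulmxDl. Qed.

Lemma GammaZ (R : realType) (n : nat) (sigma X : 'M[R[i]]_n) r a :
  Gamma sigma r (a *: X) = a *: Gamma sigma r X.
Proof. by rewrite /Gamma -scalemxAr -scalemxAl. Qed.

Lemma Lpnorm_powR (R : realType) (n : nat) (sigma X : 'M[R[i]]_n) p : p != 0 ->
  Lpnorm sigma p X `^ p = complex.Re (\tr (mxpow (Gamma sigma p^-1 X) p)).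
Proof.
by move=> p0; rewrite /Lpnorm -powRrM mulVf// powRr1// trace_mxpow_ge0.
Qed.

Lemma Lpnorm1 (R : realType) (n : nat) (sigma X : 'M[R[i]]_n) :
  psdmx sigma -> (forall k, 0 < eigval sigma k) -> psdmx X -> \tr (sigma *m X) = 1 ->
  Lpnorm sigma 1 X = 1.
Proof.
move=> spsd s0 Xpsd sX; rewrite /Lpnorm mxpow1; last exact: Gamma_psd.
rewrite /Gamma invr1 mxtrace_mulC mulmxA mxpowD//.
by rewrite -splitr mxpow1// sX /= powR1.
Qed.

(** The powers of sigma on either side of the matrix power combine, since
    1 / hat p = 1 - 1/p and 1/2 - (1 - 1/p) / 2 = 1 / (2 p). *)
Lemma beckner_energyE (R : realType) (n : nat) (sigma : 'M[R[i]]_n) (p : R)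
    (L : {linear 'M[R[i]]_n -> 'M[R[i]]_n}) X : p != 0 -> p != 1 ->
  (forall k, 0 < eigval sigma k) ->
  beckner_energy sigma p L X = - (hat p * p / 4) *
    complex.Re (\tr (mxpow (Gamma sigma p^-1 X) (p - 1) *m Gamma sigma p^-1 (L X))).
Proof.
move=> p0 p1 s0; rewrite /beckner_energy /kms_inner Gamma_adj mxpow_adj.
congr (_ * complex.Re _); set Z := mxpow (Gamma _ _ _) _.
have p10 : p - 1 != 0 by rewrite subr_eq0.
have e : 2^-1 + - (hat p)^-1 / 2 = p^-1 / 2 by rewrite /hat; field; apply/andP.
have e' : - (hat p)^-1 / 2 + 2^-1 = p^-1 / 2 by rewrite addrC.
have := mxpowD 2^-1 (- (hat p)^-1 / 2) s0; rewrite e.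
have := mxpowD (- (hat p)^-1 / 2) 2^-1 s0; rewrite e'.
rewrite /Gamma; move: (mxpow sigma 2^-1) (mxpow sigma (- (hat p)^-1 / 2)) => S1 S2.
move: Z (mxpow sigma (p^-1 / 2)) => Z S3 S12 S21.
rewrite !mulmxA S21 -(mulmxA (S3 *m Z)) S12.
by rewrite -!mulmxA mxtrace_mulC !mulmxA.
Qed.

Lemma le0_of_le_small (R : realType) (x K e : R) : 0 < e ->
  (forall t, 0 < t < e -> x <= K * t) -> x <= 0.
Proof.
move=> e0 h; rewrite leNgt; apply/negP => x0.
pose t := Num.min (e / 2) (x / (2 * (`|K| + 1))).
have K0 : 0 < `|K| + 1 by rewrite ltr_wpDl.
have t0 : 0 < t by rewrite /t lt_min !divr_gt0// mulr_gt0.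
have te : t < e by rewrite /t gt_min; apply/orP; left; lra.
have := h t; rewrite t0 te => /(_ isT); apply/negP; rewrite -ltNge.
have h1 : t * (`|K| + 1) <= x / 2.
  have : t <= x / (2 * (`|K| + 1)) by rewrite /t ge_min lexx orbT.
  by rewrite invfM mulrA ler_pdivlMr.
apply: (@le_lt_trans _ _ (t * (`|K| + 1))); last by lra.
by rewrite mulrC ler_wpM2l ?(ltW t0)//; apply: le_trans (ler_norm _) _; rewrite lerDl.
Qed.

(** Both sides of the Beckner inequality at X = 1 + t Y vanish at orders 0 and
    1: the left one because tr sigma = 1 and tr (sigma Y) = 0, the right one
    because L 1 = 0 and tr (sigma (L Y)) = 0.  The claim compares the coefficients of t^2. *)
Lemma beckner_linearized (R : realType) (n : nat) (sigma : 'M[R[i]]_n) (p a : R)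
    (L : {linear 'M[R[i]]_n -> 'M[R[i]]_n}) (Y : 'M[R[i]]_n) :
  p != 0 -> p != 1 -> psdmx sigma -> (forall k, 0 < eigval sigma k) ->
  \tr sigma = 1 -> L 1%:M = 0 -> (forall X, \tr (sigma *m L X) = 0) ->
  beckner_inequality sigma p L a ->
  Y^t* = Y -> \tr (sigma *m Y) = 0 ->
  2 * a * \sum_ij beckner_kernel p (eigval sigma ij.1) (eigval sigma ij.2)
      * complex.Re (eigcoord sigma Y ij.1 ij.2 * eigcoord sigma Y ij.2 ij.1)
  <= - \sum_ij beckner_kernel p (eigval sigma ij.1) (eigval sigma ij.2)
      * complex.Re (eigcoord sigma Y ij.1 ij.2 * eigcoord sigma (L Y) ij.2 ij.1).
Proof.
move=> p0 p1 spsd s0 trs L1 trL beck Yh trY.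
have sh := psdmx_adj spsd; have p10 : p - 1 != 0 by rewrite subr_eq0.
set V := spectralmx sigma; have Vu : V \is unitarymx := spectral_unitarymx _.
set s := eigval sigma.
pose nu k := s k `^ p^-1; have nu0 k : 0 < nu k by exact: powR_gt0.
pose B := Gamma sigma p^-1 Y; pose D := Gamma sigma p^-1 (L Y).
have Bh : B^t* = B by rewrite /B Gamma_adj Yh.
have G1 : Gamma sigma p^-1 1%:M = V^t* *m realdiag nu *m V.
  by rewrite /Gamma (mulmx1 (mxpow sigma _)) (mxpowD _ _ s0) -splitr mxpowE.
have GX t : Gamma sigma p^-1 (1%:M + t%:C *: Y) = V^t* *m realdiag nu *m V + t%:C *: B.
  by rewrite GammaD GammaZ G1.
have trG X : \sum_i nu i `^ (p - 1) * complex.Re (eigcoord sigma (Gamma sigma p^-1 X) i i)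
    = complex.Re (\tr (sigma *m X)).
  rewrite -(mxtrace_eigcoord sigma (_ *m _)) eigcoordM eigcoord_herm// mxtrace_realdiag_mul.
  apply: eq_bigr => k _; rewrite Gamma_eigcoord Re_realM mulrA; congr (_ * _).
  rewrite -powRD; last by rewrite lt0r_neq0 ?implybT.
  rewrite -splitr -powRrM -powRD; last by rewrite lt0r_neq0 ?implybT.
  by have -> : p^-1 * (p - 1) + p^-1 = 1 by [field]; rewrite powRr1// ltW.
have nup : \sum_i nu i `^ p = 1.
  have := congr1 (@complex.Re R) trs; rewrite -(mxtrace_eigcoord sigma sigma) /=.
  rewrite eigcoord_herm// Re_sum => <-; apply: eq_bigr => k _.
  by rewrite !mxE eqxx /= -powRrM mulVf// powRr1// ltW.
have [e1 [K1 [e10 K10 tr2]]] :=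
  trace_mxpow_second_order p Vu nu0 Bh (erefl (eigcoord sigma B)).
have [e2 [K2 [e20 K20 tr1]]] := trace_mxpow_first_order (p - 1) Vu nu0 Bh
  (erefl (eigcoord sigma B)) (erefl (eigcoord sigma D)).
have [e3 e30 pos] := posdefmx_near1 Yh.
set D1 := \sum_ij powR_divdiff _ _ _ * _ in tr2.
set D2 := \sum_ij powR_divdiff _ _ _ * _ in tr1.
pose e := Num.min e1 (Num.min e2 e3).
have e0 : 0 < e by rewrite /e !lt_min e10 e20.
(* The coefficients of t^2; the errors, divided by t^2, are O(t). *)
have main : a * hat p * p / 2 * D1 + hat p * p / 4 * D2 <= 0.
  apply: (le0_of_le_small (K := `|a * hat p| * K1 + `|hat p * p / 4| * K2) e0).
  move=> t /andP[t0]; rewrite /e !lt_min => /and3P[te1 te2 te3].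
  have tn : `|t| = t by rewrite gtr0_norm.
  have Xpos : posdefmx (1%:M + t%:C *: Y) by apply: pos; rewrite tn.
  have trX : \tr (sigma *m (1%:M + t%:C *: Y)) = 1.
    by rewrite mulmxDr mulmx1 -scalemxAr raddfD/= mxtraceZ trs trY mulr0 addr0.
  have LX : L (1%:M + t%:C *: Y) = t%:C *: L Y.
    by rewrite raddfD/= L1 add0r linearZ.
  have := beck _ Xpos.
  have normX1 := Lpnorm1 spsd s0 (posdef_psd Xpos) trX.
  rewrite normX1 (Lpnorm_powR sigma _ p0).
  rewrite powR1 (beckner_energyE L _ p0 p1 s0) GX LX GammaZ -/D.
  rewrite -scalemxAr mxtraceZ Re_realM.
  have := tr2 t; rewrite t0 te1 => /(_ isT).
  have := tr1 t; rewrite tn => /(_ te2).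
  rewrite (trG (L Y)) (trG Y) trL trY /=.
  rewrite nup; set T1 := complex.Re _; set T2 := complex.Re _.
  set cA := a * hat p; set cB := hat p * p / 4 => h1 h2 h3.
  have t20 : 0 < t ^+ 2 by rewrite exprn_gt0.
  rewrite -(ler_pM2r t20).
  set r1 := T1 - _ in h1; set r2 := T2 - _ in h2.
  have -> : (cA * p / 2 * D1 + cB * D2) * t ^+ 2 =
      cA * (T2 - 1) + cB * (t * T1) - cA * r2 - cB * t * r1 by rewrite /r1 /r2; field.
  have b2 : - (cA * r2) <= `|cA| * (K1 * t ^+ 3).
    by apply: le_trans (ler_norm _) _; rewrite normrN normrM ler_wpM2l.
  have b1 : - (cB * t * r1) <= `|cB| * (K2 * t ^+ 3).
    apply: le_trans (ler_norm _) _; rewrite normrN 2!normrM tn -mulrA ler_wpM2l//.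
    by rewrite exprS mulrCA ler_wpM2l// ltW.
  have -> : (`|cA| * K1 + `|cB| * K2) * t * t ^+ 2 =
    `|cA| * (K1 * t ^+ 3) + `|cB| * (K2 * t ^+ 3) by ring.
  move: b1 b2 h3; lra.
have kerE Z : \sum_ij beckner_kernel p (s ij.1) (s ij.2) *
      complex.Re (eigcoord sigma Y ij.1 ij.2 * eigcoord sigma Z ij.2 ij.1) =
    (\sum_ij powR_divdiff (p - 1) (nu ij.1) (nu ij.2) *
      complex.Re (eigcoord sigma B ij.1 ij.2
        * eigcoord sigma (Gamma sigma p^-1 Z) ij.2 ij.1)) / (p - 1).
  rewrite mulr_suml; apply: eq_bigr => -[i j] _ /=.
  rewrite (Gamma_eigcoord sigma Y) (Gamma_eigcoord sigma Z) Re_real_mulACA.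
  rewrite /beckner_kernel -/s -/(nu i) -/(nu j).
  by field.
have kerY : _ = D1 / (p - 1) := kerE Y; have kerLY : _ = D2 / (p - 1) := kerE (L Y).
rewrite kerY kerLY.
have cE : a * hat p * p / 2 * D1 + hat p * p / 4 * D2 =
   p ^+ 2 / 4 * (2 * a * (D1 / (p - 1)) + D2 / (p - 1)) by rewrite /hat; field.
move: main; rewrite cE pmulr_rle0; first by lra.
by rewrite divr_gt0// exprn_even_gt0.
Qed.

(** * Modular covariance and Schur multipliers *)

Lemma beckner_kernel_gt0 (R : realType) (p x y : R) : p != 1 -> 0 < x -> 0 < y ->
  0 < beckner_kernel p x y.
Proof.
move=> p1 x0 y0; rewrite mulr_gt0 ?powR_divdiff_gt0 ?powR_gt0 ?subr_eq0//.
by rewrite exprn_gt0// mulr_gt0 ?powR_gt0.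
Qed.

Lemma beckner_kernelC (R : realType) (p x y : R) :
  beckner_kernel p x y = beckner_kernel p y x.
Proof. by rewrite /beckner_kernel powR_divdiffC (mulrC (x `^ _)). Qed.

(** The exponents (p - 2) / p and 4 / (2 p) add up to 1: this is why the kernel
    is homogeneous of degree one. *)
Lemma beckner_exponents (R : realType) (p x : R) : p != 0 -> 0 < x ->
  (x `^ p^-1) `^ (p - 1 - 1) * (x `^ (p^-1 / 2) * x `^ (p^-1 / 2)) ^+ 2 = x.
Proof.
move=> p0 x0; have D u v : x `^ u * x `^ v = x `^ (u + v).
  by rewrite powRD// lt0r_neq0// implybT.
rewrite -powRrM expr2 !D; have -> : p^-1 * (p - 1 - 1) +
  (p^-1 / 2 + p^-1 / 2 + (p^-1 / 2 + p^-1 / 2)) = 1 by field.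
by rewrite powRr1// ltW.
Qed.

Lemma beckner_kernel_homo (R : realType) (p l x y : R) : p != 0 ->
  0 < l -> 0 < x -> 0 < y ->
  beckner_kernel p (l * x) (l * y) = l * beckner_kernel p x y.
Proof.
move=> p0 l0 x0 y0; rewrite /beckner_kernel.
rewrite !(powRM _ (ltW l0) (ltW x0)) !(powRM _ (ltW l0) (ltW y0)).
rewrite powR_divdiff_homo ?powR_gt0// -[in RHS](beckner_exponents p0 l0).
by ring.
Qed.

Lemma beckner_kernel_diag (R : realType) (p x : R) : p != 0 -> p != 1 -> 0 < x ->
  beckner_kernel p x x = x.
Proof.
move=> p0 p1 x0; rewrite /beckner_kernel /powR_divdiff eqxx.
rewrite (mulrC (p - 1)) mulfK ?subr_eq0//; exact: beckner_exponents.
Qed.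

Lemma mxtrace_inj (C : comNzRingType) (n : nat) (A B : 'M[C]_n) :
  (forall X, \tr (X *m A) = \tr (X *m B)) -> A = B.
Proof.
move=> AB; apply/matrixP => i j; have := AB (delta_mx j i).
have trd M : \tr (delta_mx j i *m M) = M i j :> C.
  rewrite mxtrace_mul (bigD1 (j, i))//= mxE !eqxx mul1r big1 ?addr0//.
  by move=> [k l]; rewrite xpair_eqE mxE /= => /negPf ->; rewrite mul0r.
by rewrite !trd.
Qed.

Lemma gns_mean0 (R : realType) (n : nat) (sigma : 'M[R[i]]_n)
    (L : {linear 'M[R[i]]_n -> 'M[R[i]]_n}) X :
  gns_detailed_balance sigma L -> L 1%:M = 0 -> \tr (sigma *m L X) = 0.
Proof.
move=> db L1; have := db 1%:M X.
rewrite /gns_inner L1 trmx0 map_mx0 mulmx0 mul0mx mxtrace0.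
by rewrite trmx1 map_mx1 mulmx1 => <-.
Qed.

(** L commutes with the modular map Y |-> sigma^-1 Y sigma = Y'.  As L preserves
    adjoints, GNS symmetry reads tr (sigma (L X) Z) = tr (sigma X (L Z)), and
    by cyclicity the roles of X and Z can be exchanged at the price of a
    modular twist. *)
Lemma gns_modular (R : realType) (n : nat) (sigma : 'M[R[i]]_n)
    (L : {linear 'M[R[i]]_n -> 'M[R[i]]_n}) (Y Y' : 'M[R[i]]_n) :
  gns_detailed_balance sigma L -> (forall X, (L X)^t* = L (X^t*)) ->
  sigma *m Y' = Y *m sigma -> sigma *m L Y' = L Y *m sigma.
Proof.
move=> db Ladj YY'.
have swap X Z : \tr (sigma *m L X *m Z) = \tr (sigma *m X *m L Z).
  by have := db (X^t*) Z; rewrite /gns_inner Ladj !trmxCK.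
apply: mxtrace_inj => X.
have -> : \tr (X *m (L Y *m sigma)) = \tr (L X *m (Y *m sigma)).
  rewrite (mulmxA X) mxtrace_mulC (mulmxA sigma) -swap.
  by rewrite -(mulmxA sigma) mxtrace_mulC -mulmxA.
by rewrite -YY' [RHS]mxtrace_mulC -swap [LHS]mxtrace_mulC.
Qed.

Lemma eigcoordZ (R : realType) (n : nat) (sigma X : 'M[R[i]]_n) c :
  eigcoord sigma (c *: X) = c *: eigcoord sigma X.
Proof. by rewrite /eigcoord -scalemxAr -scalemxAl. Qed.

Lemma eigcoord_linear (R : realType) (n : nat) (sigma : 'M[R[i]]_n)
    (L : {linear 'M[R[i]]_n -> 'M[R[i]]_n}) (M : 'M[R[i]]_n) i j :
  eigcoord sigma (L (of_eigcoord sigma M)) i j =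
  \sum_kl M kl.1 kl.2 *
    eigcoord sigma (L (of_eigcoord sigma (delta_mx kl.1 kl.2))) i j.
Proof.
rewrite -(pair_bigA _ (fun k l => M k l *
    eigcoord sigma (L (of_eigcoord sigma (delta_mx k l))) i j))/=.
rewrite {1}[M]matrix_sum_delta /of_eigcoord mulmx_sumr mulmx_suml linear_sum.
rewrite /eigcoord mulmx_sumr mulmx_suml summxE; apply: eq_bigr => k _.
rewrite mulmx_sumr mulmx_suml linear_sum mulmx_sumr mulmx_suml summxE.
apply: eq_bigr => l _.
by rewrite -scalemxAr -scalemxAl linearZ/= -scalemxAr -scalemxAl mxE.
Qed.

(** Matrix units in the eigenbasis of sigma are eigenvectors of the modular map,
    with eigenvalues s_l / s_k, and L preserves its eigenspaces. *)
Lemma eigcoord_modular (R : realType) (n : nat) (sigma : 'M[R[i]]_n)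
    (L : {linear 'M[R[i]]_n -> 'M[R[i]]_n}) i j k l :
  sigma^t* = sigma ->
  gns_detailed_balance sigma L -> (forall X, (L X)^t* = L (X^t*)) ->
  let s := eigval sigma in
  let c := eigcoord sigma (L (of_eigcoord sigma (delta_mx k l))) i j in
  c != 0 -> s i * s l = s k * s j.
Proof.
move=> sh db Ladj s; set E := of_eigcoord _ _ => c c0.
have commE : sigma *m ((s l)%:C *: E) = ((s k)%:C *: E) *m sigma.
  apply: (@eigcoord_inj _ _ sigma); rewrite !eigcoordM eigcoord_herm//.
  rewrite !eigcoordZ of_eigcoordK -scalemxAr -scalemxAl.
  apply/matrixP => a b; rewrite [LHS]mxE [RHS]mxE realdiag_mull realdiag_mulr !mxE.
  case: (eqVneq a k) => [->|_]; case: (eqVneq b l) => [->|_] //=;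
    rewrite ?(mulr0, mul0r)//.
  by rewrite mulr1 mul1r mulrC.
have LZ a : L (a *: E) = a *: L E by rewrite linearZ.
have := gns_modular db Ladj commE; rewrite !LZ -scalemxAr -scalemxAl.
move/(congr1 (fun M => eigcoord sigma M i j)).
rewrite !eigcoordZ !eigcoordM eigcoord_herm// [LHS]mxE [RHS]mxE.
rewrite realdiag_mull realdiag_mulr -/c.
move=> h; apply: complexI; apply: (mulIf c0); rewrite !rmorphM/=.
transitivity ((s l)%:C * ((s i)%:C * c)); first by ring.
by rewrite h; ring.
Qed.

Definition schur_mul (R : realType) (n : nat) (sigma : 'M[R[i]]_n)
    (tau : 'I_n -> 'I_n -> R) (X : 'M[R[i]]_n) : 'M[R[i]]_n :=
  of_eigcoord sigma (\matrix_(i, j) ((tau i j)%:C * eigcoord sigma X i j)).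

Lemma eigcoord_schur_mul (R : realType) (n : nat) (sigma : 'M[R[i]]_n) tau X i j :
  eigcoord sigma (schur_mul sigma tau X) i j = (tau i j)%:C * eigcoord sigma X i j.
Proof. by rewrite of_eigcoordK mxE. Qed.

(** The hypothesis on tau says that tau i j is a function of s_i / s_j, so that
    Schur multiplication by tau is a function of the modular map. *)
Lemma schur_mul_commutes (R : realType) (n : nat) (sigma : 'M[R[i]]_n)
    (L : {linear 'M[R[i]]_n -> 'M[R[i]]_n}) (tau : 'I_n -> 'I_n -> R) X :
  sigma^t* = sigma ->
  gns_detailed_balance sigma L -> (forall X, (L X)^t* = L (X^t*)) ->
  (forall i j k l, eigval sigma i * eigval sigma l = eigval sigma k * eigval sigma j ->
    tau i j = tau k l) ->
  L (schur_mul sigma tau X) = schur_mul sigma tau (L X).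
Proof.
move=> sh db Ladj tauP; apply: (@eigcoord_inj _ _ sigma); apply/matrixP => i j.
rewrite eigcoord_schur_mul eigcoord_linear -[X in eigcoord sigma (L X)](eigcoordK sigma).
rewrite (eigcoord_linear sigma L (eigcoord sigma X)) mulr_sumr; apply: eq_bigr => -[k l] _ /=.
rewrite mxE; set c := eigcoord sigma (L _) i j.
have [->|c0] := eqVneq c 0; first by rewrite !mulr0.
by rewrite (tauP i j k l) ?mulrA//; apply: eigcoord_modular c0.
Qed.

Lemma kms_eigcoord (R : realType) (n : nat) (sigma X Y : 'M[R[i]]_n) :
  complex.Re (kms_inner sigma X Y) =
  \sum_ij eigval sigma ij.1 `^ 2^-1 * eigval sigma ij.2 `^ 2^-1
    * complex.Re (eigcoord sigma (X^t*) ij.1 ij.2 * eigcoord sigma Y ij.2 ij.1).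
Proof.
rewrite /kms_inner -(mxtrace_eigcoord sigma).
rewrite (eigcoordM sigma _ Y) (eigcoordM sigma _ (mxpow _ _)) (eigcoordM sigma _ (X^t*)).
rewrite eigcoord_mxpow mxtrace_mul Re_sum; apply: eq_bigr => -[i j] _ /=.
rewrite realdiag_mulr realdiag_mull -Re_realM rmorphM/=.
by congr complex.Re; ring.
Qed.

(** * From the Beckner kernel to the Poincare inequality *)

(** The square root of the ratio of the KMS kernel to the Beckner kernel: both
    arguments of a sesquilinear form are multiplied by it. *)
Definition kms_multiplier (R : realType) (p x y : R) : R :=
  Num.sqrt (x `^ 2^-1 * y `^ 2^-1 / beckner_kernel p x y).

Lemma kms_multiplierC (R : realType) (p x y : R) :
  kms_multiplier p x y = kms_multiplier p y x.
Proof. by rewrite /kms_multiplier beckner_kernelC (mulrC (x `^ _)). Qed.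

Lemma kms_multiplierE (R : realType) (p x y : R) : p != 1 -> 0 < x -> 0 < y ->
  beckner_kernel p x y * kms_multiplier p x y ^+ 2 = x `^ 2^-1 * y `^ 2^-1.
Proof.
move=> p1 x0 y0; have k0 := beckner_kernel_gt0 p1 x0 y0.
rewrite sqr_sqrtr; last by rewrite divr_ge0 ?(ltW k0)// mulr_ge0 ?powR_ge0.
by rewrite mulrC divfK// lt0r_neq0.
Qed.

Lemma powR_half_sqr (R : realType) (x : R) : 0 < x -> x `^ 2^-1 * x `^ 2^-1 = x.
Proof. by move=> x0; rewrite -expr2 powR12_sqrt ?sqr_sqrtr ?ltW. Qed.

Lemma kms_multiplier_diag (R : realType) (p x : R) : p != 0 -> p != 1 -> 0 < x ->
  kms_multiplier p x x = 1.
Proof.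
move=> p0 p1 x0; rewrite /kms_multiplier beckner_kernel_diag// powR_half_sqr//.
by rewrite divff ?sqrtr1// lt0r_neq0.
Qed.

(** Both kernels are homogeneous of degree one, so their ratio depends on x / y
    only. *)
Lemma kms_multiplier_ratio (R : realType) (p x y x' y' : R) : p != 0 ->
  0 < x -> 0 < y -> 0 < x' -> x * y' = x' * y ->
  kms_multiplier p x y = kms_multiplier p x' y'.
Proof.
move=> p0 x0 y0 x'0 E; pose l := x' / x.
have l0 : 0 < l by rewrite divr_gt0.
have xn0 : x != 0 by rewrite lt0r_neq0.
have -> : x' = l * x by rewrite divfK.
have -> : y' = l * y by rewrite /l mulrAC -E mulrAC mulfV// mul1r.
rewrite /kms_multiplier (beckner_kernel_homo p0 l0 x0 y0).
rewrite (powRM _ (ltW l0) (ltW x0)) (powRM _ (ltW l0) (ltW y0)) mulrACA.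
rewrite powR_half_sqr//.
by rewrite -[in RHS]mulf_div divff ?mul1r// lt0r_neq0.
Qed.

(** The linearized Beckner inequality at the Schur multiple Y of X, which is
    again Hermitian and of mean zero (the multiplier is 1 on the diagonal) and
    for which L Y is the Schur multiple of L X. *)
Lemma hermitian_gap (R : realType) (n : nat) (sigma : 'M[R[i]]_n) (p a : R)
    (L : {linear 'M[R[i]]_n -> 'M[R[i]]_n}) (X : 'M[R[i]]_n) :
  p != 0 -> p != 1 -> psdmx sigma -> (forall k, 0 < eigval sigma k) ->
  \tr sigma = 1 -> L 1%:M = 0 -> (forall X, (L X)^t* = L (X^t*)) ->
  gns_detailed_balance sigma L ->
  beckner_inequality sigma p L a ->
  X^t* = X -> \tr (sigma *m X) = 0 ->
  2 * a * complex.Re (kms_inner sigma X X) <= - complex.Re (kms_inner sigma X (L X)).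
Proof.
move=> p0 p1 spsd s0 trs L1 Ladj db beck Xh trX.
have sh := psdmx_adj spsd; set s := eigval sigma.
have trL Z : \tr (sigma *m L Z) = 0 := gns_mean0 Z db L1.
pose tau i j := kms_multiplier p (s i) (s j).
pose Y := schur_mul sigma tau X.
have LY : L Y = schur_mul sigma tau (L X).
  by apply: schur_mul_commutes => // i j k l; apply: kms_multiplier_ratio.
have coordY i j : eigcoord sigma Y i j = (tau i j)%:C * eigcoord sigma X i j.
  exact: eigcoord_schur_mul.
have coordLY i j : eigcoord sigma (L Y) i j = (tau i j)%:C * eigcoord sigma (L X) i j.
  by rewrite LY; exact: eigcoord_schur_mul.
clearbody Y; clear LY.
have Yh : Y^t* = Y.
  apply: (@eigcoord_inj _ _ sigma); rewrite eigcoord_adj; apply/matrixP => i j.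
  rewrite [LHS]mxE [_^T _ _]mxE !coordY rmorphM/= conj_realc.
  rewrite /tau kms_multiplierC; congr (_ * _).
  by rewrite -{2}Xh eigcoord_adj [RHS]mxE [in RHS]mxE.
have trY : \tr (sigma *m Y) = 0.
  rewrite -[RHS]trX -(mxtrace_eigcoord sigma (sigma *m Y)).
  rewrite -(mxtrace_eigcoord sigma (sigma *m X)) (eigcoordM _ _ Y) (eigcoordM _ _ X).
  rewrite (eigcoord_herm sh); apply: eq_bigr => i _.
  rewrite (realdiag_mull s (eigcoord sigma Y)) (realdiag_mull s (eigcoord sigma X)).
  by rewrite coordY /tau kms_multiplier_diag// mul1r.
have := beckner_linearized p0 p1 spsd s0 trs L1 trL beck Yh trY.
have kerE W Z : (forall i j, eigcoord sigma W i j = (tau i j)%:C * eigcoord sigma Z i j) ->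
    \sum_ij beckner_kernel p (s ij.1) (s ij.2) *
      complex.Re (eigcoord sigma Y ij.1 ij.2 * eigcoord sigma W ij.2 ij.1) =
    complex.Re (kms_inner sigma X Z).
  move=> coordW; rewrite kms_eigcoord Xh; apply: eq_bigr => -[i j] _ /=.
  rewrite coordY coordW Re_real_mulACA mulrA; congr (_ * _).
  rewrite -(kms_multiplierE p1 (s0 i) (s0 j)) /tau (kms_multiplierC p (s j)).
  by rewrite expr2.
by rewrite (kerE _ _ coordY) (kerE _ _ coordLY).
Qed.

Lemma kms_innerDl (R : realType) (n : nat) (sigma X Y Z : 'M[R[i]]_n) :
  kms_inner sigma (X + Y) Z = kms_inner sigma X Z + kms_inner sigma Y Z.
Proof. by rewrite /kms_inner adjD mulmxDr !mulmxDl raddfD. Qed.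

Lemma kms_innerDr (R : realType) (n : nat) (sigma X Y Z : 'M[R[i]]_n) :
  kms_inner sigma Z (X + Y) = kms_inner sigma Z X + kms_inner sigma Z Y.
Proof. by rewrite /kms_inner mulmxDr raddfD. Qed.

Lemma kms_innerZl (R : realType) (n : nat) (sigma X Z : 'M[R[i]]_n) c :
  kms_inner sigma (c *: X) Z = Num.conj c * kms_inner sigma X Z.
Proof. by rewrite /kms_inner adjZ -scalemxAr -!scalemxAl mxtraceZ. Qed.

Lemma kms_innerZr (R : realType) (n : nat) (sigma X Z : 'M[R[i]]_n) c :
  kms_inner sigma Z (c *: X) = c * kms_inner sigma Z X.
Proof. by rewrite /kms_inner -scalemxAr mxtraceZ. Qed.

Lemma kms_innerNl (R : realType) (n : nat) (sigma X Z : 'M[R[i]]_n) :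
  kms_inner sigma (- X) Z = - kms_inner sigma X Z.
Proof. by rewrite -scaleN1r kms_innerZl rmorphN1 mulN1r. Qed.

Lemma kms_innerNr (R : realType) (n : nat) (sigma X Z : 'M[R[i]]_n) :
  kms_inner sigma Z (- X) = - kms_inner sigma Z X.
Proof. by rewrite -scaleN1r kms_innerZr mulN1r. Qed.

Lemma kms_inner_adj (R : realType) (n : nat) (sigma X Y : 'M[R[i]]_n) :
  complex.Re (kms_inner sigma (X^t*) (Y^t*)) = complex.Re (kms_inner sigma X Y).
Proof.
have conj_tr (A : 'M[R[i]]_n) : Num.conj (\tr A) = \tr (A^t*).
  by rewrite trace_map_mx mxtrace_tr.
rewrite /kms_inner trmxCK; have := mxpow_adj sigma 2^-1.
move: (mxpow sigma 2^-1) => S Sh.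
transitivity (complex.Re (Num.conj (\tr (S *m X^t* *m S *m Y)))); last by case: (\tr _).
rewrite conj_tr.
by rewrite !adjM trmxCK Sh [in RHS]mxtrace_mulC !mulmxA.
Qed.

(** The Hermitian matrices Z + Z^dag and i (Z - Z^dag) satisfy the inequality;
    by the parallelogram identity their sum is 4 times the inequality for Z. *)
Lemma beckner_poincare (R : realType) (n : nat) (sigma : 'M[R[i]]_n) (p a : R)
    (L : {linear 'M[R[i]]_n -> 'M[R[i]]_n}) (Z : 'M[R[i]]_n) :
  p != 0 -> p != 1 -> psdmx sigma -> (forall k, 0 < eigval sigma k) ->
  \tr sigma = 1 -> L 1%:M = 0 -> (forall X, (L X)^t* = L (X^t*)) ->
  gns_detailed_balance sigma L ->
  beckner_inequality sigma p L a -> \tr (sigma *m Z) = 0 ->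
  2 * a * complex.Re (kms_inner sigma Z Z) <= - complex.Re (kms_inner sigma Z (L Z)).
Proof.
move=> p0 p1 spsd s0 trs L1 Ladj db beck trZ.
have sh := psdmx_adj spsd.
have trZ' : \tr (sigma *m Z^t*) = 0.
  rewrite mxtrace_mulC -[in X in _ *m X]sh -adjM.
  by rewrite trace_map_mx mxtrace_tr trZ; apply: rmorph0.
pose A := Z + Z^t*; pose B := 'i%R *: (Z - Z^t*).
have Ah : A^t* = A by rewrite /A adjD trmxCK addrC.
have Bh : B^t* = B.
  rewrite /B adjZ conjCi adjD raddfN/= map_mxN trmxCK.
  by rewrite scaleNr -scalerN opprB.
have trA : \tr (sigma *m A) = 0 by rewrite mulmxDr raddfD/= trZ trZ' addr0.
have trB : \tr (sigma *m B) = 0.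
  by rewrite -scalemxAr mxtraceZ mulmxBr raddfB/= trZ trZ' subrr mulr0.
have LA : L A = L Z + (L Z)^t* by rewrite Ladj raddfD.
have LB : L B = 'i%R *: (L Z - (L Z)^t*) by rewrite Ladj linearZ/= raddfB.
(* The cross terms have opposite signs in the two summands. *)
have par X Y : complex.Re (kms_inner sigma (X + X^t*) (Y + Y^t*)) +
    complex.Re (kms_inner sigma ('i%R *: (X - X^t*)) ('i%R *: (Y - Y^t*))) =
    4 * complex.Re (kms_inner sigma X Y).
  rewrite kms_innerZl kms_innerZr mulrA conjCi mulNr -expr2 sqrCi opprK mul1r.
  rewrite !kms_innerDl !kms_innerDr !kms_innerNl !kms_innerNr opprK.
  have := kms_inner_adj sigma X Y; move: (X^t*) (Y^t*) => X' Y'.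
  move: (kms_inner sigma X' Y') (kms_inner sigma X' Y) (kms_inner sigma X Y').
  move: (kms_inner sigma X Y) => k1 k2 k3 k4.
  by rewrite !Re_add !Re_opp => ->; ring.
have gapA := hermitian_gap p0 p1 spsd s0 trs L1 Ladj db beck Ah trA.
have gapB := hermitian_gap p0 p1 spsd s0 trs L1 Ladj db beck Bh trB.
have parZ := par Z Z; have parL := par Z (L Z).
rewrite -/A -/B -LA -LB in parL; rewrite -/A -/B in parZ.
have : 2 * a * (4 * complex.Re (kms_inner sigma Z Z))
    <= - (4 * complex.Re (kms_inner sigma Z (L Z))).
  by rewrite -parZ -parL mulrDr opprD lerD.
by rewrite mulrCA -mulrN ler_pM2l.
Qed.

Lemma kms_inner_gt0 (R : realType) (n : nat) (sigma Z : 'M[R[i]]_n) :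
  (forall k, 0 < eigval sigma k) -> Z != 0 ->
  0 < complex.Re (kms_inner sigma Z Z).
Proof.
move=> s0 Z0; pose C := eigcoord sigma Z.
have -> : complex.Re (kms_inner sigma Z Z) =
    \sum_ij eigval sigma ij.1 `^ 2^-1 * eigval sigma ij.2 `^ 2^-1
      * complex.Re (`|C ij.2 ij.1| ^+ 2).
  rewrite kms_eigcoord eigcoord_adj -/C; apply: eq_bigr => ij _.
  by rewrite normCK [_^t* _ _]mxE [_^T _ _]mxE (mulrC (C ij.2 ij.1)).
have term0 z : 0 <= complex.Re (`|z : R[i]| ^+ 2).
  by rewrite -ler0c RRe_real ?exprn_ge0// rpredX// normr_real.
have term_gt0 z : z != 0 -> 0 < complex.Re (`|z : R[i]| ^+ 2).
  move=> z0; rewrite -ltcR RRe_real; last by rewrite rpredX// normr_real.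
  by rewrite exprn_gt0// normr_gt0.
have [i [j Cij]] : exists i, exists j, C i j != 0.
  apply: contrapT => C0; move/eqP: Z0; apply; apply: (@eigcoord_inj _ _ sigma).
  apply/matrixP => i j; apply: contrapT => /eqP Cij; apply: C0; exists i, j.
  by apply: contraNneq Cij; rewrite /C => ->; rewrite /eigcoord mulmx0 mul0mx mxE.
rewrite (bigD1 (j, i))// ltr_wpDr//.
  by apply: sumr_ge0 => kl _; rewrite !mulr_ge0 ?powR_ge0 ?term0.
rewrite mulr_gt0//; first by rewrite mulr_gt0 ?powR_gt0.
exact: term_gt0.
Qed.

Theorem lemma3p18 (R : realType) (n : nat)
  (P : R -> {linear 'M[R[i]]_n -> 'M[R[i]]_n})
  (L : {linear 'M[R[i]]_n -> 'M[R[i]]_n})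
  (sigma : 'M[R[i]]_n)
  (hP : is_QMS P)
  (hL : is_generator P L)
  (hprim : primitive P)
  (hsigma : invariant_state P sigma)
  (hDB : gns_detailed_balance sigma L)
  (p : R) (hp0 : p != 0) (hp1 : p != 1) :
  (2%:E * beckner_constant sigma p L <= poincare_constant sigma L)%E.
Proof.
have [[spsd trs] _] := hsigma.
have rk : \rank sigma = n by have [rho [_ uniq rk]] := hprim; rewrite (uniq _ hsigma).
have s0 k : 0 < eigval sigma k by exact: psdmx_eigval_gt0.
have L1 := generator_unital hP hL; have Ladj := generator_adj hP hL.
have sh := psdmx_adj spsd.
apply: le_ereal_inf_tmp => _ [X /= Xns <-].
rewrite -lee_pdivlMl// -EFinM; apply: ge_ereal_sup => _ [a beck <-].
rewrite lee_fin ler_pdivlMl// /poincare_quotient.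
set Z := X - _; set c := \tr (sigma *m X).
have Z0 : Z != 0.
  apply: contraNneq Xns => /eqP; rewrite subr_eq0 => /eqP ->.
  exact: scalar_mx_is_scalar.
have trZ : \tr (sigma *m Z) = 0.
  by rewrite mulmxBr raddfB/= mul_mx_scalar mxtraceZ trs mulr1 subrr.
rewrite ler_pdivlMr; last exact: kms_inner_gt0.
have := beckner_poincare hp0 hp1 spsd s0 trs L1 Ladj hDB beck trZ.
have LZ : L Z = L X.
  by rewrite raddfB/= -scalemx1 linearZ/= L1 scaler0 subr0.
have kms1 : kms_inner sigma (- c%:M) (L X) = 0.
  rewrite kms_innerNl -scalemx1 kms_innerZl /kms_inner trmx1 map_mx1.
  rewrite (mulmx1 (mxpow _ _)) (mxpowD _ _ s0).
  have -> : 2^-1 + 2^-1 = 1 :> R by field.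
  by rewrite (mxpow1 spsd) (gns_mean0 _ hDB L1) mulr0 oppr0.
by rewrite LZ [kms_inner sigma Z (L X)]kms_innerDl kms1 addr0.
Qed.
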